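(* Let $V$ have dimension $2$ and let $P$ and $Q$ be $\mathbb{L}$-polygons in $V$. Then $\mathcal{U}_P=\mathcal{U}_Q$ (that is, $|P\cap\mathbb{L}'|=|Q\cap\mathbb{L}'|$ for every rank-$2$ lattice $\mathbb{L}'\supseteq\mathbb{L}$ in $V$) if and only if the following two conditions are satisfied: (i) $\operatorname{Area}(P)=\operatorname{Area}(Q)$; (ii) there exist $\mathbb{L}$-polygons $X$ and $Y$, each allowed to degenerate to a segment or a single point (i.e. each is the convex hull of a nonempty finite subset of $\mathbb{L}$), such that $P$ is a lattice translate of $X+Y$ and $Q$ is a lattice translate of $X-Y$.
   Context: $V$ is a real vector space of dimension $2$ and $\mathbb{L}\subset V$ is a lattice of rank $2$ (the $\mathbb{Z}$-span of a basis of $V$). An $\mathbb{L}$-polytope is the convex hull of a nonempty finite set of points of $\mathbb{L}$; an $\mathbb{L}$-polygon is a two-dimensional $\mathbb{L}$-polytope in $V$, except that for $X$ and $Y$ in (ii) segments and single points are also allowed. For a finite set $A$, $|A|$ is its cardinality. The universal counting function of an $\mathbb{L}$-polytope $P$ is the function $\mathcal{U}_P$ assigning to each rank-$2$ lattice $\mathbb{L}'\supseteq\mathbb{L}$ in $V$ the number $\mathcal{U}_P(\mathbb{L}')=|P\cap\mathbb{L}'|$. $X+Y=\{x+y: x\in X, y\in Y\}$ and $X-Y=\{x-y:x\in X,y\in Y\}$ (Minkowski sum of $X$ with $Y$, respectively with $-Y$). A lattice translate of a set $S$ is a set $S+v$ with $v\in\mathbb{L}$. $\operatorname{Area}$ is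 any fixed Lebesgue measure on $V$ (for instance normalized so that a fundamental parallelogram of $\mathbb{L}$ has area $1$). *)

(* Defs.v *)
From HB Require Import structures.
From mathcomp Require Import all_boot all_order all_algebra finmap.
From mathcomp Require Import all_classical all_reals all_analysis.

Set Implicit Arguments.
Unset Strict Implicit.
Unset Printing Implicit Defensive.

Import Order.TTheory GRing.Theory Num.Theory.
Local Open Scope classical_set_scope.
Local Open Scope ring_scope.

Section LatticePolytopes.
Context {R : realType} {V : vectType R}.
Implicit Types (A P S X Y L : set V) (U : {vspace V}) (x : V).

(* A full-rank lattice: its rank is the dimension of V. *)
Definition is_lattice L : Prop :=
  exists2 b : (\dim {:V}).-tuple V,
    basis_of {:V} b & L = [set v | inIntSpan b v].

Definition convex_hull A : set V := smallest (@convex_set R V) A.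

Definition flat x U : set V := [set x + u | u in [set` U]].

Definition is_flat S : Prop := exists x U, S = flat x U.

Definition affine_hull A : set V := smallest is_flat A.

Definition has_affine_dim A (k : nat) : Prop :=
  exists x U, affine_hull A = flat x U /\ \dim U = k.

Definition lattice_polytope L P : Prop :=
  exists A, [/\ finite_set A, A !=set0, A `<=` L & P = convex_hull A].

Definition lattice_polygon L P : Prop :=
  lattice_polytope L P /\ has_affine_dim P 2.

Definition superlattice L : Type :=
  {L' : set V | is_lattice L' /\ L `<=` L'}.

(* [fset_set] returns the empty finite set on an infinite set, but the
   intersection of a polytope with a lattice is finite. *)
Definition universal_counting L P (L' : superlattice L) : nat :=
  #|` fset_set (P `&` sval L')|.

Definition minkowski_sum X Y : set V := [set x + y | x in X & y in Y].

Definition minkowski_diff X Y : set V := [set x - y | x in X & y in Y].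

Definition lattice_translate L S P : Prop :=
  exists2 v, L v & P = [set s + v | s in S].

(* The Lebesgue measure on a plane V for which the parallelogram spanned by the
   basis e has area 1.  Rescaling a vector of e rescales the measure, so every
   Lebesgue measure on V is [area e] for some basis e. *)
Definition area (e : 2.-tuple V) S : \bar R :=
  (lebesgue_measure \x lebesgue_measure)%E
    [set c : measurableTypeR R * measurableTypeR R |
      S (c.1 *: e`_0 + c.2 *: e`_1)].

End LatticePolytopes.

Arguments universal_counting {R V} L P L'.

(* Main.v *)
(* In coordinates for which a superlattice L' is Z^2, an L-polygon is given by its
   lowest leftmost vertex and the edge vectors E of its lower and F of its upper
   boundary, both oriented lexicographically upwards.  The only condition on E
   and F is that they have the same sum.  Minkowski sums concatenate these lists
   and x |-> -x exchanges them.

   Counting along columns gives Pick's formula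
     2 |P \cap L'| = 2 + (lattice perimeter of P) + 2 area(P) / det L'.
   Its perimeter term is additive under Minkowski sums and invariant under -1,
   so X + Y and X - Y have the same perimeter, and if they also have the same
   area they have the same counting function.

   Conversely, for L' = L / k Pick's formula gives the area, and for L' refined
   only in the direction of a primitive vector u it gives the total lattice
   length of the edges parallel to u.  Hence the lists E ++ F of P and Q, with
   all edges split into primitive ones, are permutations of each other; X and Y
   come from a common refinement of the two splittings: X takes E_P \cap E_Q and
   F_P \cap F_Q, and Y takes the rest of P.

   The Lebesgue area is identified with the area in Pick's formula by packing and
   covering with translates of a fundamental parallelogram of L / k. *)
Require Import Defs.
From mathcomp Require Import all_boot all_order all_algebra finmap.
From mathcomp Require Import all_classical all_reals all_analysis.
From mathcomp Require Import measurable_realfun.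
From mathcomp Require Import zify ring lra.

Set Implicit Arguments.
Unset Strict Implicit.
Unset Printing Implicit Defensive.

Import Order.TTheory GRing.Theory Num.Theory.
Local Open Scope classical_set_scope.
Local Open Scope ring_scope.

(** Polygons are handled through support functions instead of cyclic vertex lists: [polygon p E F]
    is cut out by all real normals n, and an edge u enters only as max(0, n.u). The order of the
    lists then matters only for counting columns, and points, segments and parallel edges behave
    like everything else, as required for summands X and Y that may degenerate. The obstacle is that
    the orientation of edges depends on the coordinates: another basis of the same lattice
    distributes the edges differently over lower and upper boundary, possibly with opposite signs.
    Lists belonging to two bases are therefore compared through widths. The width in direction n is
    half the sum of |n.u| over E ++ F, which sees neither the signs nor the splitting. For the area
    only translations and homotheties are used: the measure of a fundamental parallelogram stays an
    unspecified positive finite constant, which cancels when P and Q are compared. *)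

Definition lexpos (u : int * int) : bool := (0 < u.1) || (u.1 == 0) && (0 < u.2).

Definition det (u v : int * int) : int := u.1 * v.2 - u.2 * v.1.

Lemma detDr u v w : det u (v + w) = det u v + det u w.
Proof. by rewrite /det /=; ring. Qed.

Lemma detNr u v : det u (- v) = - det u v.
Proof. by rewrite /det /=; ring. Qed.

Lemma detC u v : det u v = - det v u.
Proof. by rewrite /det; ring. Qed.

Lemma detxx u : det u u = 0.
Proof. by rewrite /det; ring. Qed.

(** * Lower boundary chains *)

Section PlaneGeometry.
Context {R : realType}.
Implicit Types (n z : R * R) (u v w p : int * int) (A E F : seq (int * int)).

Definition emb u : R * R := (u.1%:~R, u.2%:~R).

Definition dot n z : R := n.1 * z.1 + n.2 * z.2.

Lemma dotDr n x y : dot n (x + y) = dot n x + dot n y.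
Proof. by rewrite /dot /=; ring. Qed.

Lemma dotNr n x : dot n (- x) = - dot n x.
Proof. by rewrite /dot /=; ring. Qed.

Lemma dotBr n x y : dot n (x - y) = dot n x - dot n y.
Proof. by rewrite dotDr dotNr. Qed.

Lemma dotNl n x : dot (- n) x = - dot n x.
Proof. by rewrite /dot /=; ring. Qed.

Lemma dot0r n : dot n 0 = 0.
Proof. by rewrite /dot /= !mulr0 addr0. Qed.

Lemma emb0 : emb 0 = 0. Proof. by []. Qed.

Lemma embD u v : emb (u + v) = emb u + emb v.
Proof. by rewrite /emb /= !intrD. Qed.

Lemma embN u : emb (- u) = - emb u.
Proof. by rewrite /emb /= !intrN. Qed.

Lemma embB u v : emb (u - v) = emb u - emb v.
Proof. by rewrite embD embN. Qed.

Lemma emb_inj : injective emb.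
Proof. by move=> [a b] [c d] [/intr_inj -> /intr_inj ->]. Qed.

Lemma dot_sum n E : dot n (emb (\sum_(u <- E) u)) = \sum_(u <- E) dot n (emb u).
Proof.
elim: E => [|u E IH]; first by rewrite !big_nil emb0 dot0r.
by rewrite !big_cons embD dotDr IH.
Qed.

Lemma pos_emb u : lexpos u ->
  0 < (emb u).1 \/ (emb u).1 = 0 /\ 0 < (emb u).2.
Proof.
rewrite /lexpos /emb /= => /orP[|/andP[/eqP-> h]]; first by rewrite ltr0z; left.
by right; rewrite ltr0z.
Qed.

Lemma posD u v : lexpos u -> lexpos v -> lexpos (u + v).
Proof. rewrite /lexpos /=; lia. Qed.

Lemma sum_pos E : all lexpos E -> E != [::] -> lexpos (\sum_(u <- E) u).
Proof.
elim: E => // u [|v E] IH /andP[pu pE] _; first by rewrite big_seq1.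
by rewrite big_cons posD// IH.
Qed.

Lemma det_emb u v : ((det u v)%:~R : R) = (emb u).1 * (emb v).2 - (emb u).2 * (emb v).1.
Proof. by rewrite /det intrB !intrM. Qed.

(* For a downward normal [n], the positive vectors with positive product with [n]
   form an initial sector in the order of slopes. *)
Lemma sector n u v : n.2 <= 0 -> lexpos u -> lexpos v -> 0 <= det u v ->
  0 < dot n (emb v) -> 0 < dot n (emb u).
Proof.
move=> n2 /pos_emb pu /pos_emb pv; rewrite -(ler0z R) det_emb /dot.
case: (emb u) pu => a b; case: (emb v) pv => c d; case: n n2 => s t /= t0.
move=> pu pv duv nv.
case: pv => [c0|[c0 d0]]; last by exfalso; rewrite /= in c0 d0 nv; nra.
case: pu => [a0|[a0 b0]]; last by exfalso; rewrite /= in a0 b0 nv duv; nra.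
have : 0 < (s * a + t * b) * c by nra.
by rewrite pmulr_lgt0.
Qed.

(* The support function of the zonotope [\sum_(u <- E) [0, u]]. *)
Definition zon n E : R := \sum_(u <- E) Num.max 0 (dot n (emb u)).

Lemma zon_ge0 n E : 0 <= zon n E.
Proof. by apply: sumr_ge0 => u _; rewrite le_max lexx. Qed.

Lemma zon_cons n u E : zon n (u :: E) = Num.max 0 (dot n (emb u)) + zon n E.
Proof. by rewrite /zon big_cons. Qed.

Lemma zon_cat n E F : zon n (E ++ F) = zon n E + zon n F.
Proof. by rewrite /zon big_cat. Qed.

Lemma zon_perm n E F : perm_eq E F -> zon n E = zon n F.
Proof. by move=> h; apply: perm_big. Qed.

Lemma maxr0N (x : R) : Num.max 0 x = x + Num.max 0 (- x).
Proof. by case: (ltrP 0 x) => h; case: (ltrP 0 (-x)) => h'; lra. Qed.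

Lemma zonN n E : zon n E = dot n (emb (\sum_(u <- E) u)) + zon (- n) E.
Proof.
rewrite dot_sum /zon -big_split /=; apply: eq_bigr => u _.
by rewrite dotNl maxr0N.
Qed.

Lemma zon_eq0 n E : (forall u, u \in E -> dot n (emb u) <= 0) -> zon n E = 0.
Proof.
move=> h; rewrite /zon big_seq big1// => u /h; case: ltrP => //; lra.
Qed.

(* The support function of the polygon with lexicographically smallest vertex
   [p], lower boundary with edge vectors [E] and upper boundary with edge
   vectors [F].  Both boundaries are traversed from left to right, vertical edges
   upwards, and the edges are listed in any order. *)
Definition suppf p E F n : R := dot n (emb p) + (if n.2 <= 0 then zon n E else zon n F).

Definition valid E F : Prop :=
  [/\ all lexpos E, all lexpos F & \sum_(u <- E) u = \sum_(u <- F) u].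

(** Says that [suppf p E F] is the support function of the convex hull of A, which for finite A is a
    maximum over A. *)
Definition edges A p E F : Prop := valid E F /\
  forall n, (forall a, a \in A -> dot n (emb a) <= suppf p E F n) /\
            exists2 a, a \in A & dot n (emb a) = suppf p E F n.

(** No edge points to the left, so for a horizontal normal all products have the same sign and the
    maxima add up. Hence E and F with equal sums agree there, and it does not matter that [suppf]
    assigns the horizontal normals to E. *)
Lemma zon_horizontal E n : all lexpos E -> n.2 = 0 ->
  zon n E = Num.max 0 (dot n (emb (\sum_(u <- E) u))).
Proof.
move=> pE n2; rewrite dot_sum; elim: E pE => [|u E IH] /=.
  by rewrite /zon !big_nil maxxx.
move=> /andP[/pos_emb pu pE]; rewrite zon_cons IH// big_cons.
have h : 0 <= \sum_(j <- E) (emb j).1.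
  rewrite big_seq; apply: sumr_ge0 => v /(allP pE)/pos_emb; lra.
have -> : \sum_(j <- E) dot n (emb j) = n.1 * \sum_(j <- E) (emb j).1.
  by rewrite mulr_sumr; apply: eq_bigr => j _; rewrite /dot n2 mul0r addr0.
have hu : 0 <= (emb u).1 by lra.
rewrite /dot n2 mul0r addr0.
move: (emb u).1 hu (\sum_(j <- E) _) h => a a0 b b0.
have [n0|n0] := lerP 0 n.1.
  by rewrite !max_r ?addr_ge0 ?mulr_ge0.
by rewrite !max_l ?addr0 -?mulrDr ?mulr_le0_ge0 ?addr_ge0// ltW.
Qed.

Definition lexle u v := (u == v) || lexpos (v - u).

Lemma lexle_total : total lexle.
Proof. move=> [a b] [c d]; rewrite /lexle /lexpos !xpair_eqE /=; lia. Qed.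

Lemma lexle_trans : transitive lexle.
Proof. move=> [a b] [c d] [e f]; rewrite /lexle /lexpos !xpair_eqE /=; lia. Qed.

Lemma lexle_anti u v : lexle u v -> lexle v u -> u = v.
Proof.
by case: u v => a b [c d]; rewrite /lexle /lexpos !xpair_eqE /= => h1 h2; congr pair; lia.
Qed.

Lemma lexleN u v : lexle (- u) (- v) = lexle v u.
Proof. by rewrite /lexle eqr_opp opprK addrC eq_sym. Qed.

Lemma seq_min (T : eqType) (r : rel T) (P : pred T) (s : seq T) x : {in P &, total r} ->
  {in P & &, transitive r} -> all P s -> x \in s ->
  exists2 m, m \in s & forall y, y \in s -> r m y.
Proof.
move=> rt rtr; elim: s x => // a s IH x /= /andP[Pa Ps] _.
case: s IH Ps => [|b s] IH Ps.
  exists a; rewrite ?inE// => y; rewrite inE => /eqP->.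
  by have := rt a a Pa Pa; rewrite orbb.
have [m ms mmin] := IH b Ps (mem_head _ _).
have Pm := allP Ps m ms.
have /orP[am|ma] := rt a m Pa Pm.
  exists a; first exact: mem_head.
  move=> y; rewrite inE => /orP[/eqP->|ys]; first by have := rt a a Pa Pa; rewrite orbb.
  by apply: (rtr m) (mmin y ys) => //; exact: (allP Ps).
exists m; first by rewrite inE ms orbT.
by move=> y; rewrite inE => /orP[/eqP->//|/mmin].
Qed.

Definition slope u v := 0 <= det u v.

Lemma slope_total : {in lexpos &, total slope}.
Proof. move=> [a b] [c d] _ _; rewrite /slope /det /=; lia. Qed.

Lemma slope_trans : {in lexpos & &, transitive slope}.
Proof.
move=> [a b] [c d] [e f]; rewrite /slope /det /lexpos !unfold_in /= => pu pv pw h1 h2.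
have [a0|a0] : 0 < a \/ (a = 0 /\ 0 < b) by lia.
  have : 0 <= (c * f - d * e) * a by nia.
  by rewrite pmulr_lge0.
nia.
Qed.

(** Gift wrapping: from the lexicographic minimum p step along the least steep vector u, discard the
    points before p + u, and recurse. If u is not positive for n, then by [sector] nothing beats p.
    If it is, a discarded point a loses to p + u, because p + u - a is at most as steep as u and so
    is positive for n too. *)
Lemma lower_chain A : A != [::] -> exists p q E,
  [/\ p \in A, forall a, a \in A -> lexle p a,
      q \in A, forall a, a \in A -> lexle a q &
      [/\ all lexpos E, p + \sum_(u <- E) u = q &
       forall n, n.2 <= 0 ->
        (forall a, a \in A -> dot n (emb a) <= dot n (emb p) + zon n E) /\
        exists2 a, a \in A & dot n (emb a) = dot n (emb p) + zon n E]].
Proof.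
have [k] := ubnP (size A); elim: k A => // k IH A szA A0.
have [x xA] : exists x, x \in A by case: A A0 {szA} => // x A _; exists x;
  rewrite mem_head.
have [p pA pmin] :=
  @seq_min _ lexle predT A x (in2W lexle_total) (in3W lexle_trans) (all_predT _) xA.
pose B := [seq a <- A | a != p].
have BA a : a \in B -> lexpos (a - p).
  by rewrite mem_filter => /andP[ap /pmin]; rewrite /lexle eq_sym (negPf ap).
have [B0|[y yB]] : B = [::] \/ exists y, y \in B.
  by case: B {BA} => [|y B]; [left|right; exists y; rewrite mem_head].
  have Ap a : a \in A -> a = p.
    move=> aA; apply/eqP/negPn/negP => ap.
    by have : a \in B by [rewrite mem_filter ap]; rewrite B0.
  exists p, p, [::]; split=> // [a /Ap->|]; first by rewrite /lexle eqxx.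
  split=> //; first by rewrite big_nil addr0.
  move=> n _; split=> [a /Ap->|]; rewrite /zon big_nil addr0//.
  by exists p.
have [u uB umin] : exists2 u, u \in [seq b - p | b <- B] &
    forall v, v \in [seq b - p | b <- B] -> slope u v.
  apply: (@seq_min _ slope lexpos _ (y - p) slope_total slope_trans).
    by apply/allP => _ /mapP[b bB ->]; exact: BA.
  by apply/mapP; exists y.
have pu : lexpos u by case/mapP: uB => b bB ->; exact: BA.
have puA : p + u \in A.
  by case/mapP: uB => b + ->; rewrite mem_filter addrC subrK => /andP[].
pose A' := [seq a <- A | lexle (p + u) a].
have puA' : p + u \in A' by rewrite mem_filter puA /lexle eqxx.
have pup : lexle (p + u) p = false.
  by move: pu; rewrite /lexle /lexpos; case: (p) (u) => a b [c d] /=;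
    rewrite !xpair_eqE /=; lia.
have szA' : (size A' < k)%N.
  rewrite -ltnS; apply: leq_trans szA;
    rewrite ltnS size_filter -(count_predC (lexle (p + u)) A).
  rewrite -addn1 leq_add2l -has_count; apply/hasP; exists p => //=.
  by rewrite pup.
have A'0 : A' != [::] by apply: contraTneq puA' => ->.
have [p' [q [E [p'A' p'min qA' qmax [pE sE hE]]]]] := IH A' szA' A'0.
have Ep' : p' = p + u.
  have := p'min _ puA'; have : lexle (p + u) p' by move: p'A'; rewrite mem_filter =>
    /andP[].
  by move=> h1 h2; apply: lexle_anti.
subst p'.
exists p, q, (u :: E); split=> //.
- by move: qA'; rewrite mem_filter => /andP[].
- move=> a aA; have [aA'|aA'] := boolP (a \in A'); first exact: qmax.
  have : lexle a (p + u).
    have := lexle_total a (p + u); move: aA'; rewrite mem_filter aA andbT => /negPf->.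
    by rewrite orbF.
  move/lexle_trans; apply; exact: qmax.
split.
- by rewrite /= pu.
- by rewrite big_cons addrA.
move=> n n2; have [hle [b bA' hb]] := hE n n2.
have bA : b \in A by move: bA'; rewrite mem_filter => /andP[].
rewrite zon_cons.
have slopeA a : a \in A -> a != p -> lexpos (a - p) /\ slope u (a - p).
  move=> aA ap; have aB : a \in B by rewrite mem_filter ap.
  by split; [exact: BA | apply: umin; apply/mapP; exists a].
have [nu|nu] := lerP (dot n (emb u)) 0.
  have key a : a \in A -> dot n (emb a) <= dot n (emb p).
    move=> aA; have [->//|ap] := eqVneq a p.
    have [pa sa] := slopeA a aA ap.
    have := sector n2 pu pa sa; rewrite embB dotBr; lra.
  (* The maximum over the remaining points is attained at some c, and c - (p + u) is at least as
     steep as u, hence not positive for n. So the rest of the chain adds nothing. *)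
  have z0 : zon n E = 0.
    have [_ [c cA' hc]] := hE n n2.
    have cle : dot n (emb c) <= dot n (emb (p + u)).
      move: cA'; rewrite mem_filter => /andP[/predU1P[->//|pc] cA].
      have [cp|cp] := eqVneq c p; first by rewrite cp in pc;
        rewrite /lexle pc orbT in pup.
      have [pa sa] := slopeA c cA cp.
      have sc : slope u (c - (p + u)).
        by rewrite /slope opprD addrA detDr detNr detxx subr0.
      have := sector n2 pu pc sc; rewrite !embB dotBr; lra.
    have := zon_ge0 n E; lra.
  rewrite z0 !addr0; split; first by move=> a /key.
  by exists p.
have E1 : dot n (emb p) + (dot n (emb u) + zon n E) = dot n (emb (p + u)) + zon n E.
  by rewrite embD dotDr addrA.
rewrite E1; split; last by exists b.
move=> a aA; have [aA'|aA'] := boolP (a \in A'); first exact: hle.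
have pa : lexpos (p + u - a).
  have := lexle_total a (p + u); move: aA'; rewrite mem_filter aA andbT => /negPf h.
  rewrite h orbF => /predU1P[aE|//]; by move: h; rewrite aE /lexle eqxx.
have [ap|ap] := eqVneq a p.
  rewrite ap embD dotDr; have := zon_ge0 n E; lra.
have [_ sa] := slopeA a aA ap.
have sa' : slope (p + u - a) u.
  by rewrite /slope detC -detNr opprB opprD addrA detDr detNr detxx subr0.
have := sector n2 pa pu sa' nu; have := zon_ge0 n E; rewrite embB dotBr; lra.
Qed.

End PlaneGeometry.

(** * Polygons with given edges *)

Section SupportFunctions.
Context {R : realType}.
Implicit Types (n m z : R * R) (u v w p : int * int) (A E F : seq (int * int)).

(** The upper boundary of A is the lower boundary of -A: a half turn reverses the traversal and with
    it the sign of each edge, so the upward edge vectors are the same. [zonN] turns the bounds for -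
    n into bounds for n. *)
Lemma edges_exist A : A != [::] -> exists p E F, edges (R := R) A p E F.
Proof.
move=> A0; have [p [q [E [pA pmin qA qmax [pE sE hE]]]]] := @lower_chain R A A0.
have NA0 : [seq - a | a <- A] != [::] by case: A A0 {pA pmin qA qmax hE}.
have [p' [q' [F [p'A p'min q'A q'max [pF sF hF]]]]] := @lower_chain R _ NA0.
have Ep' : p' = - q.
  apply: lexle_anti; first by apply/p'min/map_f.
  by case/mapP: p'A => a aA ->; rewrite lexleN qmax.
have Eq' : q' = - p.
  apply: lexle_anti; last by apply/q'max/map_f.
  by case/mapP: q'A => a aA ->; rewrite lexleN pmin.
rewrite {}Ep' {}Eq' in sF hF.
have EF : \sum_(u <- E) u = \sum_(u <- F) u.
  by rewrite -[LHS](addKr p) sE -[RHS](addKr (- q)) sF opprK addrC.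
exists p, E, F; split=> // n; rewrite /suppf; case: ifPn => n2; first exact: hE.
have n2' : (- n).2 <= 0 by rewrite /= oppr_le0 ltW // ltNge.
have key : - dot n (emb (- q)) + zon (- n) F = dot n (emb p) + zon n F.
  rewrite (zonN n) addrA; congr (_ + _).
  by rewrite -EF -dotDr -embD sE embN dotNr opprK.
have [hle [b /mapP[a aA ->] hb]] := hF _ n2'.
split=> [c cA|].
  by have := hle (- c) (map_f _ cA); rewrite !dotNl !embN !dotNr opprK -key embN dotNr.
by exists a; rewrite // -key; move: hb; rewrite !dotNl [emb (- a)]embN dotNr opprK.
Qed.

Fixpoint subsums E : seq (int * int) :=
  if E is u :: E' then subsums E' ++ map (+%R u) (subsums E') else [:: 0].

Lemma mem_subsums (P : pred (int * int)) E : \sum_(u <- E | P u) u \in subsums E.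
Proof.
elim: E => [|u E IH]; first by rewrite big_nil.
rewrite big_cons /= mem_cat; case: ifP => _; last by rewrite IH.
by rewrite map_f ?orbT.
Qed.

Lemma dot_sub_zon n (P : pred (int * int)) E :
  dot n (emb (\sum_(u <- E | P u) u)) <= zon n E.
Proof.
rewrite -big_filter dot_sum big_filter big_mkcond; apply: ler_sum => u _.
by case: ifP => _; rewrite le_max lexx ?orbT.
Qed.

Lemma dot_pos_zon n E :
  dot n (emb (\sum_(u <- E | 0 < dot n (emb u)) u)) = zon n E.
Proof.
rewrite -big_filter dot_sum big_filter big_mkcond; apply: eq_bigr => u _.
by case: ltrP.
Qed.

(* Unless no edge is positive for both [n] and [m], the edges left out of the
   sum are nonnegative for [m], and then the sum is at most the full one. *)
Lemma cross_sum n m E F : \sum_(u <- E) u = \sum_(u <- F) u ->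
  (forall u w, u \in E -> w \in E -> 0 < dot n (emb u) -> 0 < dot m (emb u) ->
     dot n (emb w) <= 0 -> 0 <= dot m (emb w)) ->
  dot m (emb (\sum_(u <- E | 0 < dot n (emb u)) u)) <= zon m F.
Proof.
move=> EF h.
have [/hasP[u uE /andP[nu mu]]|/hasPn none] :=
    boolP (has (fun u => (0 < dot n (emb u)) && (0 < dot m (emb u))) E).
  have : dot m (emb (\sum_(u <- E | 0 < dot n (emb u)) u)) <= dot m (emb (\sum_(u <- E) u)).
    rewrite [in leRHS](bigID (fun u => 0 < dot n (emb u))) /= embD dotDr lerDl.
    rewrite -big_filter dot_sum big_filter big_seq_cond sumr_ge0// => w /andP[wE].
    by rewrite -leNgt; exact: h wE nu mu.
  move/le_trans; apply; rewrite EF.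
  by have := dot_sub_zon m predT F.
apply: le_trans (zon_ge0 m F).
rewrite -big_filter dot_sum big_filter big_seq_cond sumr_le0// => w /andP[wE nw].
by have := none w wE; rewrite nw /= -leNgt.
Qed.

(** The boundary case of [sector]: w is orthogonal to n, and n.2 < 0 keeps w from being vertical. It
    is needed because edges orthogonal to n count as not positive both for n and for - n. *)
Lemma sector_strict n u w : n.2 < 0 -> lexpos u -> lexpos w ->
  dot n (emb u) < 0 -> dot n (emb w) = 0 -> 0 <= det w u.
Proof.
move=> n2 /(@pos_emb R) pu /(@pos_emb R) pw; rewrite -(ler0z R) det_emb /dot.
case: (emb u) pu => a b; case: (emb w) pw => c d; case: n n2 => s t /= t0.
move=> pw pu nu nw.
have c0 : 0 < c by case: pw => [//|[c0 d0]]; exfalso; rewrite /= in c0 d0;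
  rewrite c0 in nw; nra.
have : 0 < (c * b - d * a) * - t by nra.
by rewrite pmulr_lgt0 ?oppr_gt0// => /ltW.
Qed.

(* The vertex extremal for [n] is [p] plus the edges that are positive for [n]. *)
Lemma edges_realize p E F : valid E F -> exists A, edges (R := R) A p E F.
Proof.
move=> [pE pF EF].
(* All vertices are subset sums of E or F. Filtering by the inequalities themselves makes the upper
   bound automatic, so only attainment remains. *)
pose A := [seq a <- map (+%R p) (subsums E ++ subsums F) |
             `[< forall n, dot n (emb a) <= suppf (R := R) p E F n >]].
have memA a : a \in subsums E ++ subsums F ->
    (forall n, dot n (emb a) <= if n.2 <= 0 then zon n E else zon n F) -> p + a \in A.
  move=> aS h; rewrite mem_filter map_f// andbT; apply/asboolP => n.
  by rewrite embD dotDr lerD2l.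
exists A; split=> // n; split=> [a|].
  by rewrite mem_filter => /andP[/asboolP + _]; apply.
rewrite /suppf; case: ifPn => n2.
  exists (p + \sum_(u <- E | 0 < dot n (emb u)) u);
    last by rewrite embD dotDr dot_pos_zon.
  apply: memA; first by rewrite mem_cat mem_subsums.
  move=> m; case: ifPn => m2; first exact: dot_sub_zon.
  apply: cross_sum => // u w uE wE nu mu nw.
  have pu := allP pE u uE; have pw := allP pE w wE.
  have m2' : (- m).2 <= 0 by rewrite /= oppr_le0 ltW // ltNge.
  have duw : 0 <= det u w.
    rewrite leNgt; apply/negP => duw.
    have : 0 <= det w u by rewrite detC oppr_ge0 ltW.
    by move/(sector n2 pw pu)/(_ nu); rewrite ltNge nw.
  rewrite leNgt; apply/negP => mw.
  have := sector m2' pu pw duw; rewrite !dotNl; lra.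
exists (p + \sum_(u <- F | 0 < dot n (emb u)) u); last by rewrite embD dotDr dot_pos_zon.
apply: memA; first by rewrite mem_cat mem_subsums orbT.
move=> m; case: ifPn => m2; last exact: dot_sub_zon.
apply: cross_sum => // u w uF wF nu mu nw.
have pu := allP pF u uF; have pw := allP pF w wF.
have n2' : (- n).2 <= 0 by rewrite /= oppr_le0 ltW // ltNge.
have dwu : 0 <= det w u.
  have [nw0|nw0] : dot n (emb w) < 0 \/ dot n (emb w) = 0 by lra.
    rewrite leNgt; apply/negP => dwu.
    have duw : 0 <= det u w by rewrite detC oppr_ge0 ltW.
    have := sector n2' pu pw duw; rewrite !dotNl; lra.
  by apply: (@sector_strict (- n)); rewrite //= ?dotNl ?oppr_lt0 ?nw0 ?oppr0 // ltNge.
by apply/ltW/(sector m2 pw pu dwu mu).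
Qed.

(** * Convexity and separation in the plane *)

Definition comb (t : R) (x y : R * R) : R * R :=
  (t * x.1 + (1 - t) * y.1, t * x.2 + (1 - t) * y.2).

Definition convex2 (C : set (R * R)) : Prop :=
  forall t x y, 0 <= t -> t <= 1 -> C x -> C y -> C (comb t x y).

(** Finitely many strict inequalities survive a common small perturbation. Separation, second
    differences and the approximation by rational normals rest on this. *)
Lemma small_eps (T : eqType) (s : seq T) (f g : T -> R) :
  (forall x, x \in s -> 0 < f x) ->
  exists2 e0, 0 < e0 & forall e, 0 <= e -> e <= e0 -> forall x, x \in s ->
    e * `|g x| < f x.
Proof.
elim: s => [|x s IH] h; first by exists 1.
have [y ys|e0 e0p he] := IH; first by apply: h; rewrite inE ys orbT.
have fx : 0 < f x by apply: h; rewrite mem_head.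
have gx : 0 < `|g x| + 1 by rewrite ltr_wpDl.
exists (Num.min e0 (f x / (`|g x| + 1))); first by rewrite lt_min e0p divr_gt0.
move=> e ep; rewrite le_min ler_pdivlMr// => /andP[e1 e2] y; rewrite inE =>
  /orP[/eqP->|ys].
  have [->|e00] := eqVneq e 0; first by rewrite mul0r.
  apply: lt_le_trans e2; rewrite ltr_pM2l ?ltrDl// lt_neqAle eq_sym e00 //.
exact: he.
Qed.

Definition cross (x y : R * R) : R := x.1 * y.2 - x.2 * y.1.

Lemma cross_separate (c : R) (a : R * R) (s : seq (R * R)) : a != 0 ->
  (forall x, x \in s -> 0 < c * cross a x) ->
  exists n, 0 < dot n a /\ forall x, x \in s -> 0 < dot n x.
Proof.
move=> a0 h; have [e e0 he] := small_eps (dot a) h.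
(* The vector c * (- a.2, a.1) is orthogonal to a and positive on s; tilting it by e * a makes it
   positive on a as well. *)
exists (- c * a.2 + e * a.1, c * a.1 + e * a.2); split.
  have : 0 < a.1 ^+ 2 + a.2 ^+ 2.
    rewrite lt_neqAle addr_ge0 ?sqr_ge0// andbT eq_sym paddr_eq0 ?sqr_ge0// !sqrf_eq0.
    by case: (a) a0 => x y; rewrite xpair_eqE.
  by rewrite /dot /= => hh; have := mulr_gt0 e0 hh; rewrite !expr2; nra.
move=> x xs; have := he e (ltW e0) (lexx _) x xs.
have := ler_norm (- dot a x); rewrite normrN => h1 h2.
have h3 : e * - dot a x <= e * `|dot a x| by rewrite ler_pM2l.
move: h2 h3; rewrite /dot /cross /=; nra.
Qed.

Lemma convex2_cone2 C (x y : R * R) (a b : R) : convex2 C -> C x -> C y ->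
  0 <= a -> 0 <= b -> 0 < a + b -> a * x.1 + b * y.1 = 0 -> a * x.2 + b * y.2 = 0 -> C 0.
Proof.
move=> cC Cx Cy a0 b0 ab e1 e2.
have ab0 : a + b != 0 by rewrite gt_eqF.
suff -> : 0 = comb (a / (a + b)) x y.
  by apply: cC => //; rewrite ?divr_ge0 ?addr_ge0// ler_pdivrMr// mul1r lerDl.
have E : 1 - a / (a + b) = b / (a + b) by field.
rewrite /comb E ![_ / _ * _]mulrAC -!mulrDl e1 e2 mul0r.
by [].
Qed.

Lemma convex2_cone3 C (x y z : R * R) (a b c : R) : convex2 C -> C x -> C y -> C z ->
  0 <= a -> 0 < b -> 0 < c ->
  a * x.1 + b * y.1 + c * z.1 = 0 -> a * x.2 + b * y.2 + c * z.2 = 0 -> C 0.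
Proof.
move=> cC Cx Cy Cz a0 b0 c0 e1 e2.
have bc : b + c != 0 by rewrite gt_eqF ?addr_gt0.
have Cw : C (comb (b / (b + c)) y z).
  apply: cC => //; first by rewrite divr_ge0 ?addr_ge0 ?ltW.
  by rewrite ler_pdivrMr ?addr_gt0// mul1r lerDl ltW.
apply: (convex2_cone2 cC Cx Cw a0 (_ : 0 <= b + c)).
- by rewrite ltW ?addr_gt0.
- by rewrite ltr_wpDl ?addr_gt0.
- by rewrite -[RHS]e1 /comb /=; field.
- by rewrite -[RHS]e2 /comb /=; field.
Qed.

(** Gordan's alternative. When a vector a is added that is not positive for the current n, either s
    lies strictly on one side of the line through a and n can be replaced, or 0 is a conical
    combination of a and vectors of s on the line or on both sides of it. *)
Lemma gordan (s : seq (R * R)) (C : set (R * R)) : convex2 C ->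
  (forall x, x \in s -> C x) ->
  C 0 \/ exists n, forall x, x \in s -> 0 < dot n x.
Proof.
move=> cC; elim: s => [|a s IH] sC; first by right; exists 0.
have Ca : C a by apply: sC; rewrite mem_head.
have sC' x : x \in s -> C x by move=> xs; apply: sC; rewrite inE xs orbT.
have [|[n hn]] := IH sC'; first by left.
have [a0|a0] := eqVneq a 0; first by left; rewrite -a0.
have [na|na] := ltrP 0 (dot n a).
  by right; exists n => x; rewrite inE => /orP[/eqP->|/hn].
have parallel x : x \in s -> cross a x = 0 -> C 0.
  move=> xs ax; have nx := hn x xs.
  apply: (convex2_cone2 cC Ca (sC' x xs) (ltW nx) (_ : 0 <= - dot n a));
    rewrite ?oppr_ge0//.
  - lra.
  - by rewrite -[RHS](mulr0 n.2) -ax /dot /cross; ring.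
  - by rewrite -[RHS](mulr0 (- n.1)) -ax /dot /cross; ring.
have side c : c != 0 -> (exists n, forall x, x \in a :: s -> 0 < dot n x) \/ C 0 \/
    exists2 x, x \in s & c * cross a x < 0.
  move=> c0; have [/hasP[x xs hx]|/hasPn h] :=
    boolP (has (fun x => c * cross a x <= 0) s).
    right; move: hx; rewrite le_eqVlt mulf_eq0 (negPf c0) /= =>
      /orP[/eqP/(parallel x xs)|]; first by left.
    by right; exists x.
  left; have [|m [ma ms]] := @cross_separate c a s a0; first by move=> x /h;
    rewrite -ltNge.
  by exists m => x; rewrite inE => /orP[/eqP->|/ms].
have [|[|[x xs hx]]] := side 1 (oner_neq0 _); [by right|by left|].
have N1 : (-1 : R) != 0 by rewrite oppr_eq0 oner_eq0.
have [|[|[y ys hy]]] := side (-1) N1; [by right|by left|].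
rewrite mul1r mulN1r oppr_lt0 in hx hy.
left; have nx := hn x xs; have ny := hn y ys.
(* Any three plane vectors satisfy (y,x) a + (x,a) y + (a,y) x = 0 with these cross products.
   Pairing with n shows that the first coefficient has the same sign as the other two. *)
have xy : cross y x * dot n a + cross x a * dot n y + cross a y * dot n x = 0.
  by rewrite /cross /dot; ring.
have hx' : 0 < cross x a by move: hx; rewrite /cross; lra.
have xy0 : 0 <= cross y x.
  rewrite leNgt; apply/negP => h; have := mulr_gt0 hx' ny; have := mulr_gt0 hy nx.
  have : 0 <= cross y x * dot n a by rewrite mulr_le0// ltW.
  lra.
apply: (convex2_cone3 cC Ca (sC' y ys) (sC' x xs) xy0 hx' hy); rewrite /cross; ring.
Qed.

(** Otherwise [gordan], applied to the translates a - z, gives a normal separating z from s. As C is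
    any convex set containing s, this yields membership in the convex hull, the smallest such
    set. *)
Lemma convex2_support (s : seq (R * R)) (C : set (R * R)) z : convex2 C ->
  (forall x, x \in s -> C x) ->
  (forall n, exists2 a, a \in s & dot n z <= dot n a) -> C z.
Proof.
move=> cC sC h.
pose C' := [set x | C (x + z)].
have cC' : convex2 C'.
  move=> t x y t0 t1 Cx Cy; rewrite /C' /=.
  suff -> : comb t x y + z = comb t (x + z) (y + z) by exact: cC.
  by congr pair; rewrite /=; ring.
have [||[n hn]] := @gordan [seq a - z | a <- s] C' cC'.
- by move=> _ /mapP[a aS ->]; rewrite /C' /= subrK; exact: sC.
- by rewrite /C' /= add0r.
have [a aS] := h (- n); rewrite !dotNl lerN2 => hz.
by have := hn (a - z) (map_f _ aS); rewrite dotBr subr_gt0 ltNge hz.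
Qed.

End SupportFunctions.

(** * Pick's formula *)

Definition lattice_length (u : int * int) : nat := gcdn `|u.1| `|u.2|.

Definition perimeter (E : seq (int * int)) : int := \sum_(u <- E) (lattice_length u)%:Z.

(* If [E] is sorted by slope, [low E j] is the ceiling of the height at abscissa
   [j] of the chain that starts at the origin and has edge vectors [E].  At a
   vertical edge the division by 0 gives 0, the height of the lower endpoint. *)
Fixpoint low (E : seq (int * int)) (j : int) : int :=
  if E is u :: E' then
    if j <= u.1 then - (- (j * u.2) %/ u.1)%Z else u.2 + low E' (j - u.1)
  else 0.

(* Twice the signed area between the chain and the horizontal axis. *)
Fixpoint trap (E : seq (int * int)) : int :=
  if E is u :: E' then u.1 * u.2 + 2 * u.2 * (\sum_(v <- E') v).1 + trap E' else 0.

Lemma sum_multiples (d k : nat) : (0 < d)%N -> (\sum_(0 <= j < d * k) (d %| j) = k)%N.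
Proof.
move=> d0; elim: k => [|k IH]; first by rewrite muln0 big_geq.
rewrite mulnS addnC (@big_cat_nat _ _ _ (d * k)) ?leq_addr//= IH.
have -> : (\sum_(d * k <= j < d * k + d) (d %| j) = \sum_(0 <= j < d) (d %| j + d * k))%N.
  by rewrite -{1}[(d * k)%N]add0n big_addn addKn.
under eq_bigr do rewrite dvdn_addl ?dvdn_mulr//.
case: d d0 {IH} => // d _; rewrite big_nat_recl// dvdn0 big_nat big1 ?addn0 ?addn1//.
by move=> i /andP[_ id]; rewrite gtnNdvd.
Qed.

(** These j are the abscissas of the lattice points on the edge (a, b), right endpoint excluded. *)
Lemma count_dvd_mul (a : nat) (b : int) : (0 < a)%N ->
  (\sum_(0 <= j < a) (a %| j * `|b|) = gcdn a `|b|)%N.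
Proof.
move=> a0; set g := gcdn a _; have g0 : (0 < g)%N by rewrite gcdn_gt0 a0.
have da : a = (a %/ g * g)%N by rewrite divnK ?dvdn_gcdl.
have ag0 : (0 < a %/ g)%N by rewrite divn_gt0// dvdn_leq ?dvdn_gcdl.
rewrite [in LHS]da -[RHS](@sum_multiples (a %/ g) g)//; apply: eq_bigr => j _.
congr nat_of_bool; rewrite -da.
have db : `|b|%N = (`|b| %/ g * g)%N by rewrite divnK ?dvdn_gcdr.
rewrite {1}da db mulnA dvdn_pmul2r// Gauss_dvdl//.
by rewrite /coprime -(eqn_pmul2r g0) mul1n muln_gcdl -da -db.
Qed.

Lemma divzN_notdvd (d x : int) : 0 < d -> ~~ (d %| x)%Z ->
  (x %/ d)%Z + (- x %/ d)%Z = - 1.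
Proof.
move=> d0 nd; have d0' : d != 0 by rewrite gt_eqF.
have h1 := divz_eq x d; have h2 := divz_eq (- x) d.
have l1 := modz_ge0 x d0'; have l2 := modz_ge0 (- x) d0'.
have u1 := ltz_pmod x d0; have u2 := ltz_pmod (- x) d0.
have n1 : (x %% d)%Z != 0 by apply: contraNneq nd => /dvdz_mod0P.
set q := _ + _; have hq : (q + 1) * d = d - (x %% d)%Z - (- x %% d)%Z by rewrite /q; lia.
have : (q + 1) * d < 1 * d by lia.
have : (- 1) * d < (q + 1) * d by lia.
rewrite !ltr_pM2r//; lia.
Qed.

(** Pair j with a - j: the two ceilings add up to b + 1, or to b if the edge has a lattice point at
    abscissa j. The pairing needs the range 0..a, so the last term is added and removed again. *)
Lemma ceil_sum (a : nat) (b : int) : (0 < a)%N ->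
  2 * (\sum_(0 <= j < a) - (- (j%:Z * b) %/ a%:Z)%Z)
  = a%:Z * b - b + a%:Z - (gcdn a `|b|)%:Z.
Proof.
move=> a0; pose c (j : nat) := - (- (j%:Z * b) %/ a%:Z)%Z.
have aZ0 : a%:Z != 0 by rewrite eqz_nat -lt0n.
have ca : c a = b by rewrite /c -mulrN mulKz ?opprK.
have refl j : (j <= a)%N -> c j + c (a - j)%N = b + 1 - (a %| j * `|b|)%N%:Z.
  move=> ja; rewrite /c -subzn// mulrBl opprB.
  have -> : (j%:Z * b - a%:Z * b = - b * a%:Z + j%:Z * b) by ring.
  rewrite divzMDl//.
  have dvE : (a %| j * `|b|)%N = (a%:Z %| j%:Z * b)%Z by rewrite dvdzE abszM.
  rewrite dvE; set x := j%:Z * b; case: (boolP (a%:Z %| x)%Z) => [/dvdzP[q ->]|nd].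
    by rewrite -mulNr !mulzK//=; lia.
  by have := divzN_notdvd (a0 : 0 < a%:Z) nd; lia.
have : \sum_(0 <= j < a.+1) c j + \sum_(0 <= j < a.+1) c j =
    \sum_(0 <= j < a.+1) (b + 1 - (a %| j * `|b|)%N%:Z).
  rewrite [X in _ + X]big_nat_rev -big_split /= !big_nat; apply: eq_bigr => j /andP[_ ja].
  by rewrite add0n subSS refl.
rewrite sumrB sumr_const_nat subn0 big_nat_recr //= ca.
rewrite [X in _ - X]big_nat_recr //= dvdn_mulr//.
rewrite -(big_morph Posz PoszD (erefl (Posz 0))) count_dvd_mul//.
rewrite -/c; move: (\sum_(0 <= j < a) c j) => S; rewrite -mulr_natl; lia.
Qed.

Lemma fstD (u v : int * int) : (u + v).1 = u.1 + v.1. Proof. by []. Qed.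

Lemma sndD (u v : int * int) : (u + v).2 = u.2 + v.2. Proof. by []. Qed.

Lemma pos_ge0 u : lexpos u -> 0 <= u.1.
Proof. rewrite /lexpos; lia. Qed.

Lemma sum_fst (E : seq (int * int)) : (\sum_(u <- E) u).1 = \sum_(u <- E) u.1.
Proof. exact: (big_morph fst). Qed.

Lemma sum_pos_ge0 E : all lexpos E -> 0 <= (\sum_(u <- E) u).1.
Proof.
by move=> pE; rewrite sum_fst big_seq sumr_ge0// => u /(allP pE); exact: pos_ge0.
Qed.

Lemma vertical_chain E : all lexpos E -> (forall u, u \in E -> u.1 = 0) ->
  [/\ trap E = 0, perimeter E = (\sum_(u <- E) u).2 & (\sum_(u <- E) u).1 = 0].
Proof.
rewrite /perimeter; elim: E => [|u E IH] /=; first by rewrite !big_nil.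
move=> /andP[pu pE] h; have [|t0 g0 s0] := IH pE; first by move=> v vE; apply: h;
  rewrite inE vE orbT.
have u0 : u.1 = 0 by apply: h; rewrite mem_head.
rewrite !big_cons /= g0 t0 s0 u0 mul0r mulr0 !addr0; split => //.
congr (_ + _); rewrite /lattice_length u0 gcd0n; move: pu; rewrite /lexpos u0; lia.
Qed.

Lemma low0 E : all lexpos E -> low E 0 = 0.
Proof.
by case: E => // u E /= /andP[pu _]; rewrite pos_ge0// mul0r oppr0 div0z oppr0.
Qed.

Lemma slope_vertical u v : lexpos u -> u.1 = 0 -> lexpos v -> slope u v -> v.1 = 0.
Proof.
rewrite /lexpos /slope /det => pu u0 pv; rewrite u0 mul0r add0r => h.
have u2 : 0 < u.2 by lia.
have : u.2 * v.1 <= 0 by lia.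
by rewrite pmulr_rle0//; lia.
Qed.

Lemma low_sum E : all lexpos E -> pairwise slope E ->
  2 * (\sum_(0 <= j < `|(\sum_(u <- E) u).1|.+1) low E j%:Z)
  = trap E + (\sum_(u <- E) u).1 - perimeter E + (\sum_(u <- E) u).2.
Proof.
elim: E => [|u E IH]; first by rewrite /perimeter !big_nil /= big_nat1.
move=> puE suE; have /= /andP[pu pE] := puE; have /= /andP[uE sE] := suE.
have {}IH := IH pE sE; have s0 := sum_pos_ge0 pE.
have [u0|u0] : u.1 = 0 \/ 0 < u.1 by have := pos_ge0 pu; lia.
  have vE : forall v, v \in u :: E -> v.1 = 0.
    move=> v; rewrite inE => /orP[/eqP->//|vE].
    exact: (slope_vertical pu u0 (allP pE v vE) (allP uE v vE)).
  have [t0 g0 h0] := vertical_chain puE vE.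
  have /= l0 := low0 puE.
  by rewrite h0 g0 -[_ + trap E]/(trap (u :: E)) t0 big_nat1 l0 mulr0 addr0 sub0r addNr.
have Es : \sum_(v <- u :: E) v = u + \sum_(v <- E) v by rewrite big_cons.
have Ep : perimeter (u :: E) = (lattice_length u)%:Z + perimeter E by rewrite /perimeter big_cons.
rewrite Es Ep {Es Ep}.
rewrite fstD sndD.
set W := (\sum_(v <- E) v).1 in s0 IH *; set s2 := (\sum_(v <- E) v).2 in IH *.
have [a a0 Ea] : exists2 a : nat, (0 < a)%N & u.1 = a%:Z by exists `|u.1|%N; lia.
have [w Ew] : exists w : nat, W = w%:Z by exists `|W|%N; lia.
rewrite Ea Ew in s0 IH *.
rewrite -PoszD absz_nat in IH *.
rewrite (@big_cat_nat _ _ _ a)//=; last by lia.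
have -> : \sum_(0 <= i < a) (if i%:Z <= a%:Z then - (- (i%:Z * u.2) %/ a)%Z
     else u.2 + low E (i%:Z - a%:Z)) = \sum_(0 <= j < a) - (- (j%:Z * u.2) %/ a%:Z)%Z.
  by rewrite !big_nat; apply: eq_bigr => i /andP[_ ia]; rewrite lez_nat (ltnW ia).
(* The common column j = a is counted with the tail; there the ceiling clause of [low] gives u.2,
   which agrees with u.2 + [low E 0]. *)
have -> : \sum_(a <= i < (a + w).+1) (if i%:Z <= a%:Z then - (- (i%:Z * u.2) %/ a)%Z
     else u.2 + low E (i%:Z - a%:Z)) = \sum_(0 <= j < w.+1) (u.2 + low E j%:Z).
  rewrite -{1}[a]add0n big_addn -addnS addKn; apply: eq_bigr => -[|i] _.
    by rewrite add0n lexx -mulrN mulKz ?opprK ?low0 ?addr0// eqz_nat -lt0n.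
  rewrite PoszD addrK ifF//; lia.
rewrite mulrDr ceil_sum// big_split /= mulrDr IH sumr_const_nat subn0 -mulr_natl.
rewrite /lattice_length Ea absz_nat; ring.
Qed.

Lemma low_edge u E (j y : int) : 0 < u.1 -> j <= u.1 ->
  (low (u :: E) j <= y) = (j * u.2 <= y * u.1).
Proof.
by move=> u0 ju; rewrite /= ju lerNl lez_divRL// mulNr lerN2.
Qed.

Lemma low_far u E (j : int) : u.1 < j -> low (u :: E) j = u.2 + low E (j - u.1).
Proof. by move=> uj; rewrite /= lt_geF. Qed.

Lemma column_mem (W x y : nat) (a b c : int) : (x < W.+1)%N ->
  0 <= c - a - b + 1 -> (y < `|(c - a - b + 1)%R|)%N ->
  [/\ 0 <= x%:Z, x%:Z <= W%:Z & b <= b + y%:Z] /\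
  [/\ 0 <= W%:Z - x%:Z, W%:Z - x%:Z <= W%:Z & a <= c - (b + y%:Z)].
Proof. by move=> xW c0 yc; split; split; lia. Qed.

Lemma column_mem_conv (W : nat) (a b c d1 d2 : int) : 0 <= d1 -> d1 <= W%:Z ->
  b <= d2 -> a <= c - d2 ->
  (`|d1| < W.+1)%N /\ (`|(d2 - b)%R| < `|(c - a - b + 1)%R|)%N.
Proof. by move=> h1 h2 h3 h4; split; lia. Qed.

Section Columns.
Context {R : realType}.
Implicit Types (n z : R * R) (u v w p : int * int) (A E F : seq (int * int)).

Lemma lower_range E (x : int * int) : all lexpos E ->
  (forall n, n.2 <= 0 -> dot n (emb x) <= zon n E) ->
  0 <= x.1 /\ x.1 <= (\sum_(u <- E) u).1.
Proof.
move=> pE h; have s0 := sum_pos_ge0 pE.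
have h1 := h (1, 0) (lexx _); have h2 := h (- 1, 0) (lexx _).
rewrite !zon_horizontal// in h1 h2.
move: h1 h2; rewrite /dot /= !mul0r !addr0 !mul1r !mulN1r.
rewrite max_r ?ler0z// ler_int => ->; rewrite max_l ?oppr_le0 ?ler0z//.
Qed.

Lemma slope_emb u (x : int * int) n : 0 < u.1 -> n.2 <= 0 -> 0 <= det u x -> 0 < x.1 ->
  dot n (emb u) < 0 -> dot n (emb x) <= 0.
Proof.
move=> u0 n2 ux x0 nu; rewrite leNgt; apply/negP => nx.
have pu : lexpos u by rewrite /lexpos u0.
have px : lexpos x by rewrite /lexpos x0.
have := sector n2 pu px ux nx; lra.
Qed.

Lemma dot_above_edge n u (x : int * int) : n.2 <= 0 -> 0 < u.1 -> 0 <= x.1 ->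
  x.1 <= u.1 ->
  x.1 * u.2 <= x.2 * u.1 -> dot n (emb x) <= Num.max 0 (dot n (emb u)).
Proof.
rewrite -(ltr0z R) -(ler0z R) -2!(ler_int R) !intrM /dot /emb /=.
move: (x.1%:~R) (x.2%:~R) (u.1%:~R) (u.2%:~R) (n.1) (n.2) => a b c d s t t0 c0 a0 ac lx.
have h1 : (s * a + t * b) * c <= (s * c + t * d) * a by nra.
rewrite le_max; have [h2|h2] := lerP 0 (s * c + t * d).
  apply/orP; right; rewrite -(ler_pM2r c0); apply: le_trans h1 _.
  by rewrite ler_wpM2l.
apply/orP; left; rewrite -(pmulr_lle0 _ c0); apply: le_trans h1 _.
by rewrite nmulr_rle0.
Qed.

(** Translates half-planes into columns by peeling off the least steep edge u. Over u the condition
    is to lie above its line; further right, x satisfies the inequalities for u :: E exactly when it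
    lies above the line of u and x - u satisfies those for E, which [low] mirrors. *)
Lemma lower_columns E (x : int * int) : all lexpos E -> pairwise slope E ->
  (forall n, n.2 <= 0 -> dot n (emb x) <= zon n E) <->
  [/\ 0 <= x.1, x.1 <= (\sum_(u <- E) u).1 & low E x.1 <= x.2].
Proof.
elim: E x => [|u E IH] x puE suE.
  split=> [h|].
    have [x0 x1] := lower_range puE h; split=> //=.
    have := h (0, - 1) (lerN10 _); rewrite /zon big_nil /dot /= mul0r add0r mulN1r.
    by rewrite oppr_le0 ler0z.
  rewrite big_nil /= => -[x0 x1 x2] n n2; rewrite /zon big_nil /dot /=.
  have -> : x.1 = 0 by apply/le_anti; rewrite x0 x1.
  by rewrite mulr0 add0r mulr_le0_ge0// ler0z.
have /= /andP[pu pE] := puE; have /= /andP[/allP uE sE] := suE.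
have Es : \sum_(v <- u :: E) v = u + \sum_(v <- E) v by rewrite big_cons.
rewrite -/(low (u :: E) x.1); split=> [h|[x0 xs lx] n n2].
  have [x0 xs] := lower_range puE h; split=> //.
  have [u0|u0] : u.1 = 0 \/ 0 < u.1 by have := pos_ge0 pu; lia.
    have vE v : v \in u :: E -> v.1 = 0.
      rewrite inE => /orP[/eqP->//|vE].
      exact: (slope_vertical pu u0 (allP pE v vE) (uE v vE)).
    have xE : x.1 = 0 by apply/le_anti; rewrite x0 andbT; have [_ _ <-] :=
      vertical_chain puE vE.
    rewrite xE low0//.
    have := h (0, - 1) (lerN10 _); rewrite zon_eq0.
      by rewrite /dot /= mul0r add0r mulN1r oppr_le0 ler0z.
    move=> v vuE; have := allP puE v vuE;
      rewrite /dot /= mul0r add0r mulN1r oppr_le0 ler0z.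
    rewrite /lexpos vE//; lia.
  (* The outward normal of the first edge: all later edges are at least as steep, so [zon] vanishes
     on it. *)
  have normal : 0 <= det u x.
    have := h (u.2%:~R, - u.1%:~R); rewrite /= oppr_le0 ler0z ltW// => /(_ isT).
    rewrite zon_eq0.
      rewrite /dot /= -(ler0z R) det_emb /=; lra.
    move=> v; rewrite inE => /orP[/eqP->|/uE]; first by rewrite /dot /=; lra.
    by rewrite /slope -(ler0z R) det_emb /dot /= subr_ge0 mulNr subr_le0.
  have [ux|ux] := lerP x.1 u.1.
    by rewrite low_edge// mulrC [_ * u.1]mulrC -subr_ge0.
  rewrite low_far// -lerBrDl.
  have : forall n, n.2 <= 0 -> dot n (emb (x - u)) <= zon n E.
    move=> n n2; have := h n n2; rewrite zon_cons embB dotBr.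
    have [nu|nu] := lerP 0 (dot n (emb u)); first by lra.
    have := @slope_emb u (x - u) n u0 n2; rewrite detDr detNr detxx subr0 /= =>
      /(_ normal).
    rewrite subr_gt0 => /(_ ux nu); rewrite embB dotBr; have := zon_ge0 n E; lra.
  by case/(IH _ pE sE).
have [u0|u0] : u.1 = 0 \/ 0 < u.1 by have := pos_ge0 pu; lia.
  have vE v : v \in u :: E -> v.1 = 0.
    rewrite inE => /orP[/eqP->//|vE].
    exact: (slope_vertical pu u0 (allP pE v vE) (uE v vE)).
  have xE : x.1 = 0 by apply/le_anti; rewrite x0 andbT; have [_ _ <-] :=
    vertical_chain puE vE.
  move: lx; rewrite xE low0// => x2; apply: le_trans (zon_ge0 _ _).
  by rewrite /dot /= xE mulr0 add0r mulr_le0_ge0// ler0z.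
have [xu|xu] := lerP x.1 u.1.
  move: lx; rewrite low_edge// zon_cons => lx; have z0 := zon_ge0 n E.
  have := dot_above_edge n2 u0 x0 xu lx; lra.
have : forall n, n.2 <= 0 -> dot n (emb (x - u)) <= zon n E.
  apply/(IH _ pE sE); split=> /=.
  - by rewrite subr_ge0 ltW.
  - by move: xs; rewrite Es /=; lia.
  - by rewrite lerBrDl -low_far.
move=> /(_ n n2); rewrite embB dotBr zon_cons.
have : dot n (emb u) <= Num.max 0 (dot n (emb u)) by rewrite le_max lexx orbT.
lra.
Qed.

Definition polygon p E F : set (R * R) := [set z | forall n, dot n z <= suppf p E F n].

(** The half turn about the centre of the segment from p to p plus the edge sum turns the upper
    boundary into a lower chain with edges F. Horizontal normals fall under both conditions and are
    reconciled by [zon_horizontal]. *)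
Lemma polygon_lattice p E F (x : int * int) : valid E F -> polygon p E F (emb x) <->
  (forall n, n.2 <= 0 -> dot n (emb (x - p)) <= zon n E) /\
  (forall n, n.2 <= 0 -> dot n (emb (\sum_(u <- F) u - (x - p))) <= zon n F).
Proof.
move=> [pE pF EF]; rewrite /polygon /suppf /=.
have eqN n : dot n (emb (\sum_(u <- F) u - (x - p))) <= zon n F <->
    dot (- n) (emb x) <= dot (- n) (emb p) + zon (- n) F.
  rewrite [zon n F]zonN !embB !dotBr !dotNl; split; lra.
split=> [h|[hE hF] n].
  split=> n n2; first by have := h n; rewrite n2 embB dotBr; lra.
  apply/eqN; have := h (- n); rewrite /= oppr_le0; case: ifP => // n2'.
  have n20 : n.2 = 0 by apply/le_anti; rewrite n2 n2'.
  by rewrite !zon_horizontal ?EF//= n20 oppr0.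
case: ifPn => n2; first by have := hE n n2; rewrite embB dotBr; lra.
have n2' : (- n).2 <= 0 by rewrite /= oppr_le0 ltW // ltNge.
by have /eqN := hF (- n) n2'; rewrite opprK.
Qed.

(* Twice the area, for [E] and [F] sorted by slope.  A half turn makes the upper
   boundary a lower chain, so it lies above [2 * s.1 * s.2 - trap F]. *)
Definition twarea E F : int :=
  2 * (\sum_(u <- E) u).1 * (\sum_(u <- E) u).2 - trap E - trap F.

(** A convex chain lies below its chord; the right-hand side is the ceiling of the height of the
    chord. *)
Lemma low_diagonal E (x : int) : all lexpos E -> pairwise slope E ->
  0 <= x -> x <= (\sum_(u <- E) u).1 ->
  low E x <= - (- (x * (\sum_(u <- E) u).2) %/ (\sum_(u <- E) u).1)%Z.
Proof.
move=> pE sE x0 xs; set s := \sum_(u <- E) u in xs *.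
have [s0|s0] : s.1 = 0 \/ 0 < s.1 by lia.
  have -> : x = 0 by apply/le_anti; rewrite x0 -s0 xs.
  by rewrite low0// s0 divz0 oppr0.
pose c := - (- (x * s.2) %/ s.1)%Z.
have /lower_columns : forall n, n.2 <= 0 -> dot n (emb (x, c)) <= zon n E.
  move=> n n2; apply: le_trans (_ : Num.max 0 (dot n (emb s)) <= _).
    apply: dot_above_edge => //=.
    by rewrite /c mulNr lerNr -mulNr -lez_divRL// mulNr.
  by rewrite ge_max zon_ge0 (dot_sub_zon n predT).
by case/(_ pE sE).
Qed.

(** The chord separates the two boundaries, so the lowest candidate is at most the ceiling and the
    highest at least the floor of its height. These differ by at most 1, so a column without lattice
    points contributes exactly 0 and never a negative number. *)
Lemma columns_nonneg E F (x : int) : valid E F -> pairwise slope E -> pairwise slope F ->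
  0 <= x -> x <= (\sum_(u <- F) u).1 ->
  0 <= (\sum_(u <- F) u).2 - low F ((\sum_(u <- F) u).1 - x) - low E x + 1.
Proof.
move=> [pE pF EF] sE sF x0 xs.
have h1 := low_diagonal pE sE x0; rewrite EF in h1; have {}h1 := h1 xs.
have := @low_diagonal F ((\sum_(u <- F) u).1 - x) pF sF.
rewrite subr_ge0 lerBlDr lerDl => /(_ xs x0) h2.
set s := \sum_(u <- F) u in xs h1 h2 *.
have [s0|s0] : s.1 = 0 \/ 0 < s.1 by lia.
  have xE : x = 0 by apply/le_anti; rewrite x0 -s0 xs.
  have s2 : 0 <= s.2.
    have [F0|F0] := eqVneq F [::]; first by rewrite /s F0 big_nil.
    by have := sum_pos pF F0; rewrite -/s /lexpos s0 ltxx => /andP[_ /ltW].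
  rewrite s0 xE subr0 !low0//; lia.
have E1 : - ((s.1 - x) * s.2) = - s.2 * s.1 + x * s.2 by ring.
rewrite E1 divzMDl ?gt_eqF// in h2.
case: (boolP (s.1 %| x * s.2)%Z) => [/dvdzP[q hq]|nd].
  by move: h1 h2; rewrite hq -mulNr !mulzK ?gt_eqF//; lia.
by have := divzN_notdvd s0 nd; lia.
Qed.

(** Degenerate polygons are included: a segment occurs once in each list, so its length enters
    twice, and empty lists give a single point. *)
Lemma pick_theorem p E F : valid E F -> pairwise slope E -> pairwise slope F ->
  exists s : seq (int * int), [/\ uniq s,
    forall x, (x \in s) <-> polygon p E F (emb x) &
    2 * (size s)%:Z = 2 + perimeter E + perimeter F + twarea E F].
Proof.
move=> vEF sE sF; have [pE pF EF] := vEF.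
pose t := \sum_(u <- F) u.
have [W EW] : exists W : nat, t.1 = W%:Z by exists `|t.1|%N; have := sum_pos_ge0 pF;
  rewrite -/t; lia.
pose cnt (x : int) := t.2 - low F (W%:Z - x) - low E x + 1.
have cnt_ge0 (x : nat) : (x <= W)%N -> 0 <= cnt x%:Z.
  by move=> xW; rewrite /cnt -EW; apply: columns_nonneg => //; rewrite -/t EW.
pose f (x y : nat) : int * int := (p.1 + x%:Z, p.2 + low E x%:Z + y%:Z).
exists [seq f x y | x <- iota 0 W.+1, y <- iota 0 `|cnt x%:Z|]; split.
- apply: allpairs_uniq_dep; first exact: iota_uniq.
    by move=> *; exact: iota_uniq.
  move=> [x y] [x' y'] _ _ /= [] /addrI [] xx'; rewrite xx' => /addrI [] ->.
  by [].
- move=> z; rewrite polygon_lattice//.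
  have [dz Edz] : exists dz, z - p = dz by exists (z - p).
  rewrite Edz.
  rewrite (lower_columns _ pE sE) (lower_columns _ pF sF) EF -/t EW.
  have -> : t - dz = (W%:Z - dz.1, t.2 - dz.2) by rewrite -EW.
  rewrite [(_, _).1]/= [(_, _).2]/=; split.
    move=> /allpairsPdep[x [y [xI yI zE]]]; rewrite !mem_iota /= !add0n in xI yI.
    have c0 : 0 <= cnt x by apply: cnt_ge0; lia.
    have -> : dz = (x%:Z, low E x%:Z + y%:Z).
      by rewrite -Edz zE; congr pair; rewrite /=; ring.
    exact: (column_mem xI c0 yI).
  case=> -[z0 z1 z2] [_ _ z3].
  apply/allpairsPdep; exists `|dz.1|%N, `|dz.2 - low E dz.1|%N.
  have Ez : (`|dz.1|%N)%:Z = dz.1 := gez0_abs z0.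
  have [h1 h2] := column_mem_conv z0 z1 z2 z3.
  rewrite !mem_iota !leq0n !add0n !Ez; split=> //.
  rewrite /f Ez gez0_abs ?subr_ge0// addrACA addrA.
  by rewrite -Edz /=; case: (z) (p) => a b [c d] /=; congr pair; ring.
rewrite size_allpairs_dep sumnE big_map.
have -> : (\sum_(x <- iota 0 W.+1) size (iota 0 `|cnt x%:Z|))%N%:Z = \sum_(0 <= x < W.+1) cnt x%:Z.
  rewrite (big_morph Posz PoszD (erefl (Posz 0))); apply: eq_big_seq => x.
  by rewrite mem_iota size_iota /= => xW; rewrite gez0_abs// cnt_ge0//; lia.
have E1 : \sum_(0 <= x < W.+1) cnt x%:Z = W.+1%:Z * (t.2 + 1)
    - \sum_(0 <= x < W.+1) low F x%:Z - \sum_(0 <= x < W.+1) low E x%:Z.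
  have -> : \sum_(0 <= x < W.+1) low F x%:Z = \sum_(0 <= x < W.+1) low F (W%:Z - x%:Z).
    rewrite big_nat_rev !big_nat; apply: eq_bigr => i /andP[_ iW].
    by rewrite add0n subSS subzn.
  rewrite /cnt big_split /= !sumrB !sumr_const_nat subn0 -mulr_natl natz.
  move: (\sum_(0 <= i < W.+1) low F _) (\sum_(0 <= i < W.+1) low E _) => a b.
  by move: (W.+1%:Z) (t.2) => c d; ring.
have := low_sum pE sE; have := low_sum pF sF.
rewrite EF -/t EW absz_nat /twarea EF -/t EW E1 => h1 h2.
rewrite !mulrBr h1 h2; lia.
Qed.
End Columns.

(** * Minkowski sums and dilations *)

(** The effect on coordinates of dividing the two basis vectors of the lattice by k1 and k2; unequal
    factors refine the lattice in one direction only. *)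
Definition dilate (k1 k2 : nat) (u : int * int) : int * int := (k1%:Z * u.1, k2%:Z * u.2).

Lemma dilateD k1 k2 u v : dilate k1 k2 (u + v) = dilate k1 k2 u + dilate k1 k2 v.
Proof. by rewrite /dilate /= !mulrDr. Qed.

Lemma dilate_sum k1 k2 E :
  \sum_(u <- map (dilate k1 k2) E) u = dilate k1 k2 (\sum_(u <- E) u).
Proof.
rewrite big_map; symmetry; apply: (big_morph (dilate k1 k2)) => [u v|];
  first exact: dilateD.
by rewrite /dilate /= !mulr0.
Qed.

Section Dilation.
Context (k1 k2 : nat).
Context (k1_gt0 : (0 < k1)%N) (k2_gt0 : (0 < k2)%N).

Lemma dilate_pos u : lexpos (dilate k1 k2 u) = lexpos u.
Proof.
rewrite /lexpos /= !pmulr_rgt0 ?ltz_nat// mulf_eq0.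
by rewrite -[k1%:Z == 0]/(k1 == 0%N) (gtn_eqF k1_gt0).
Qed.

Lemma dilate_all_pos E : all lexpos (map (dilate k1 k2) E) = all lexpos E.
Proof. by rewrite all_map; apply: eq_all => u /=; exact: dilate_pos. Qed.

Lemma valid_dilate E F : valid E F -> valid (map (dilate k1 k2) E) (map (dilate k1 k2) F).
Proof. by case=> pE pF EF; split; rewrite ?dilate_all_pos// !dilate_sum EF. Qed.

Lemma det_dilate u v : det (dilate k1 k2 u) (dilate k1 k2 v) = (k1 * k2)%N%:Z * det u v.
Proof. by rewrite /det /= PoszM; ring. Qed.

Lemma slope_dilate E : pairwise slope (map (dilate k1 k2) E) = pairwise slope E.
Proof.
rewrite pairwise_map; apply: eq_pairwise => u v; rewrite /slope /= det_dilate.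
by rewrite pmulr_rge0// ltz_nat muln_gt0 k1_gt0.
Qed.
End Dilation.

Lemma trap_dilate k1 k2 E : trap (map (dilate k1 k2) E) = (k1 * k2)%N%:Z * trap E.
Proof.
elim: E => [|u E IH] /=; first by rewrite mulr0.
by rewrite IH dilate_sum /= PoszM; ring.
Qed.

Lemma twarea_dilate k1 k2 E F :
  twarea (map (dilate k1 k2) E) (map (dilate k1 k2) F) = (k1 * k2)%N%:Z * twarea E F.
Proof. by rewrite /twarea !trap_dilate dilate_sum /= PoszM; ring. Qed.

Lemma lattice_length_dilate k u : lattice_length (dilate k k u) = (k * lattice_length u)%N.
Proof. by rewrite /lattice_length /= !abszM !absz_nat muln_gcdr. Qed.

Lemma perimeter_cat E F : perimeter (E ++ F) = perimeter E + perimeter F.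
Proof. by rewrite /perimeter big_cat. Qed.

Lemma perimeter_perm E F : perm_eq E F -> perimeter E = perimeter F.
Proof. by move=> h; apply: perm_big. Qed.

Lemma perimeter_dilate k E : perimeter (map (dilate k k) E) = k%:Z * perimeter E.
Proof.
by rewrite /perimeter big_map mulr_sumr; apply: eq_bigr => u _;
  rewrite lattice_length_dilate PoszM.
Qed.

Lemma valid_cat E F E' F' : valid E F -> valid E' F' -> valid (E ++ E') (F ++ F').
Proof.
by case=> pE pF s [pE' pF' s']; split;
  rewrite ?all_cat ?pE ?pE' ?pF ?pF'// !big_cat /= s s'.
Qed.

Lemma valid_sym E F : valid E F -> valid F E.
Proof. by case. Qed.

Lemma valid_perm E F E' F' : perm_eq E E' -> perm_eq F F' -> valid E F -> valid E' F'.
Proof.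
move=> hE hF [pE pF s]; split; rewrite -?(perm_all _ hE) -?(perm_all _ hF)//.
by rewrite -(perm_big _ hE) -(perm_big _ hF).
Qed.

Lemma slope_sort E : all lexpos E -> exists2 E', perm_eq E E' & pairwise slope E'.
Proof.
move=> pE; exists (sort slope E); first by rewrite perm_sym perm_sort.
rewrite -(sorted_pairwise_in slope_trans) ?all_sort//.
by apply: (sort_sorted_in slope_total).
Qed.

Section SupportAlgebra.
Context {R : realType}.
Local Notation edges := (@edges R).
Local Notation polygon := (@polygon R).
Implicit Types (n z : R * R) (u v w p : int * int) (A E F : seq (int * int)).

Lemma dot_comb t n x y : dot n (comb t x y) = t * dot n x + (1 - t) * dot n y :> R.
Proof. by rewrite /dot /comb /=; ring. Qed.

Lemma polygon_convex p E F : convex2 (polygon p E F).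
Proof.
move=> t x y t0 t1 Kx Ky n; rewrite dot_comb.
have := Kx n; have := Ky n; move: (dot n x) (dot n y) (suppf p E F n) => a b c h1 h2.
have : t * b <= t * c by apply: ler_wpM2l.
have : t * a <= t * c by apply: ler_wpM2l.
have : (1 - t) * b <= (1 - t) * c by rewrite ler_wpM2l ?subr_ge0.
lra.
Qed.

Lemma polygon_edges A p E F z : edges A p E F ->
  polygon p E F z <-> forall n, exists2 a, a \in A & dot n z <= dot n (emb a).
Proof.
move=> [_ h]; split=> [Kz n|hz n].
  by have [_ [a aA ha]] := h n; exists a; rewrite ?ha.
by have [a aA] := hz n; move/le_trans; apply; have [+ _] := h n; exact.
Qed.

Lemma edges_in A p E F a : edges A p E F -> a \in A -> polygon p E F (emb a).
Proof. by move=> h aA; apply/(polygon_edges _ h) => n; exists a. Qed.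

Lemma polygon_min A p E F (C : set (R * R)) : edges A p E F -> convex2 C ->
  (forall a, a \in A -> C (emb a)) -> polygon p E F `<=` C.
Proof.
move=> h cC AC z /(polygon_edges _ h) hz; apply: (convex2_support (s := map emb A) cC).
  by move=> _ /mapP[a aA ->]; exact: AC.
by move=> n; have [a aA ha] := hz n; exists (emb a) => //; exact: map_f.
Qed.

Lemma suppfD p q E F E' F' n :
  suppf (p + q) (E ++ E') (F ++ F') n = suppf p E F n + suppf q E' F' n :> R.
Proof. by rewrite /suppf embD dotDr; case: ifP; rewrite zon_cat; lra. Qed.

(** Sums satisfy the added inequalities. Conversely, the Minkowski sum is convex and contains the
    sums a + b of realizing points, and these have the support function of the left-hand side. *)
Lemma polygon_add p q E F E' F' z : valid E F -> valid E' F' ->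
  polygon (p + q) (E ++ E') (F ++ F') z <-> exists x y,
    [/\ polygon p E F x, polygon q E' F' y & z = x + y].
Proof.
move=> v v'; split=> [Kz|[x [y [Kx Ky ->]]] n]; last first.
  by rewrite dotDr suppfD lerD.
have [A hA] := @edges_realize R p _ _ v; have [B hB] := @edges_realize R q _ _ v'.
have hAB : edges [seq a + b | a <- A, b <- B] (p + q) (E ++ E') (F ++ F').
  split; first exact: valid_cat.
  move=> n; rewrite suppfD; split.
    move=> _ /allpairsP[[a b] /= [aA bB ->]]; rewrite embD dotDr lerD//.
      by have [+ _] := hA.2 n; exact.
    by have [+ _] := hB.2 n; exact.
  have [_ [a aA ha]] := hA.2 n; have [_ [b bB hb]] := hB.2 n.
  exists (a + b); first by apply/allpairsP; exists (a, b).
  by rewrite embD dotDr ha hb.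
apply: (polygon_min (C := [set z | exists x y, [/\ polygon p E F x, polygon q E' F' y & z = x + y]]) hAB) Kz.
  move=> t _ _ t0 t1 /= [x [y [Kx Ky ->]]] [x' [y' [Kx' Ky' ->]]].
  exists (comb t x x'), (comb t y y'); split; try exact: polygon_convex.
  by rewrite /comb; congr pair; rewrite /=; ring.
move=> _ /allpairsP[[a b] /= [aA bB ->]]; exists (emb a), (emb b).
by split; rewrite ?embD//; [exact: edges_in hA aA|exact: edges_in hB bB].
Qed.

(** The lexicographically largest vertex, p plus the edge sum, becomes the smallest one after
    negation, whence the new base point. *)
Lemma polygon_opp p E F z : valid E F ->
  polygon (- p - \sum_(u <- E) u) F E z <-> polygon p E F (- z).
Proof.
move=> [pE pF EF].
have key n : suppf (- p - \sum_(u <- E) u) F E n = suppf (R := R) p E F (- n).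
  rewrite /suppf embB embN dotBr dotNr dotNl /= oppr_le0.
  have hE := zonN n E; have hF := zonN n F; rewrite EF in hE *.
  case: ifPn => n2; case: ifPn => n2'; try lra.
  have n20 : n.2 = 0 by apply/le_anti; rewrite n2 n2'.
  have : zon (- n) E = zon (- n) F by rewrite !zon_horizontal ?EF//= n20 oppr0.
  lra.
by split=> h n; have := h (- n); rewrite key ?opprK dotNr dotNl ?opprK.
Qed.

Lemma polygon_shift p v E F z : polygon (p + v) E F (z + emb v) <-> polygon p E F z.
Proof.
by split=> h n; have := h n; rewrite /suppf embD !dotDr; lra.
Qed.

Lemma polygon_perm p E F E' F' : perm_eq E E' -> perm_eq F F' ->
  polygon p E F = polygon p E' F'.
Proof.
move=> hE hF; apply/seteqP; split=> z h n; have := h n; rewrite /suppf.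
  by rewrite (zon_perm _ hE) (zon_perm _ hF).
by rewrite -(zon_perm _ hE) -(zon_perm _ hF).
Qed.

Lemma polygon_attained p E F n : valid E F ->
  exists2 a, polygon p E F (emb a) & dot n (emb a) = suppf p E F n.
Proof.
move=> v; have [A hA] := @edges_realize R p _ _ v.
by have [_ [a aA ha]] := hA.2 n; exists a => //; exact: edges_in hA aA.
Qed.

Lemma zon_dilate k1 k2 E n :
  zon n (map (dilate k1 k2) E) = zon (k1%:R * n.1, k2%:R * n.2) E :> R.
Proof.
rewrite /zon big_map; apply: eq_bigr => u _; congr Num.max.
by rewrite /dot /= !intrM -!pmulrn; ring.
Qed.

Lemma polygon_dilate k1 k2 p E F z : (0 < k1)%N -> (0 < k2)%N ->
  polygon (dilate k1 k2 p) (map (dilate k1 k2) E) (map (dilate k1 k2) F) (k1%:R * z.1, k2%:R * z.2)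
  <-> polygon p E F z.
Proof.
move=> k1p k2p; have k1p' : 0 < k1%:R :> R by rewrite ltr0n.
have k2p' : 0 < k2%:R :> R by rewrite ltr0n.
have key n : suppf (dilate k1 k2 p) (map (dilate k1 k2) E) (map (dilate k1 k2) F) n =
    suppf (R := R) p E F (k1%:R * n.1, k2%:R * n.2).
  rewrite /suppf !zon_dilate /= pmulr_rle0//; congr (_ + _).
  by rewrite /dot /= !intrM -!pmulrn; ring.
split=> h n; last by rewrite key; have := h (k1%:R * n.1, k2%:R * n.2);
  rewrite /dot /=; lra.
have := h (n.1 / k1%:R, n.2 / k2%:R); rewrite key /= !mulrA.
rewrite [k1%:R * n.1]mulrC [k2%:R * n.2]mulrC !mulfK ?gt_eqF//.
rewrite -surjective_pairing /dot /=; congr (_ <= _); field.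
by rewrite !gt_eqF.
Qed.

End SupportAlgebra.

(** * Edges and widths *)

(** A two-by-two table with rows A, B and columns C, D: X and Y form the first row, Y' and X' the
    second. Replacing Y by -Y exchanges Y and Y', hence the pairing of X with Y'. *)
Lemma perm_refine (T : eqType) (A B C D : seq T) : perm_eq (A ++ B) (C ++ D) ->
  exists X X' Y Y', [/\ perm_eq A (X ++ Y), perm_eq B (X' ++ Y'),
    perm_eq C (X ++ Y') & perm_eq D (X' ++ Y)].
Proof.
elim: A C D => [|a A IH] C D h.
  by exists [::], D, [::], C; rewrite !cat0s cats0; split=> //;
    rewrite perm_sym perm_catC perm_sym.
have : a \in C ++ D by rewrite -(perm_mem h) mem_head.
rewrite mem_cat => /orP[aC|aD].
  have hC := perm_to_rem aC.
  have [|X [X' [Y [Y' [h1 h2 h3 h4]]]]] := IH (rem a C) D.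
    rewrite -(perm_cons a); apply: perm_trans h _.
    by rewrite -cat_cons perm_cat2r.
  exists (a :: X), X', Y, Y'; split=> //; first by rewrite /= perm_cons.
  by apply: perm_trans hC _; rewrite /= perm_cons.
have hD := perm_to_rem aD.
have [|X [X' [Y [Y' [h1 h2 h3 h4]]]]] := IH C (rem a D).
  rewrite -(perm_cons a); apply: perm_trans h _.
  by rewrite perm_sym -[a :: _]cat1s perm_catCA perm_cat2l perm_sym.
exists X, X', (a :: Y), Y'; split=> //.
  by rewrite -[a :: Y]cat1s perm_sym perm_catCA /= perm_cons perm_sym.
apply: perm_trans hD _.
by rewrite -[a :: Y]cat1s perm_sym perm_catCA /= perm_cons perm_sym.
Qed.

Definition prim (u : int * int) : bool := lattice_length u == 1%N.

Definition primdiv (u : int * int) : int * int :=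
  ((u.1 %/ (lattice_length u)%:Z)%Z, (u.2 %/ (lattice_length u)%:Z)%Z).

Definition refine (E : seq (int * int)) : seq (int * int) :=
  flatten [seq nseq (lattice_length u) (primdiv u) | u <- E].

Lemma lattice_length_gt0 u : lexpos u -> (0 < lattice_length u)%N.
Proof. by rewrite /lexpos /lattice_length gcdn_gt0 !lt0n !absz_eq0; lia. Qed.

Lemma primdivK u : u = ((lattice_length u)%:Z * (primdiv u).1, (lattice_length u)%:Z * (primdiv u).2).
Proof.
rewrite /primdiv /= ![_%:Z * _]mulrC !divzK; first by case: u.
  by rewrite dvdzE absz_nat dvdn_gcdr.
by rewrite dvdzE absz_nat dvdn_gcdl.
Qed.

Lemma pos_primdiv u : lexpos u -> lexpos (primdiv u).
Proof.
move=> pu; have g0 := lattice_length_gt0 pu; move: pu; rewrite {1}(primdivK u).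
by rewrite -/(dilate _ _ _) dilate_pos.
Qed.

Lemma prim_primdiv u : lexpos u -> prim (primdiv u).
Proof.
move=> pu; have g0 := lattice_length_gt0 pu; have :=
  lattice_length_dilate (lattice_length u) (primdiv u).
rewrite {1}/dilate -primdivK => /esym/eqP.
by rewrite -{2}[lattice_length u]muln1 eqn_pmul2l.
Qed.

Lemma refine_cons u E : refine (u :: E) = nseq (lattice_length u) (primdiv u) ++ refine E.
Proof. by []. Qed.

Lemma all_refine (P : pred (int * int)) E :
  (forall u, u \in E -> P (primdiv u)) -> all P (refine E).
Proof.
move=> h; apply/allP => v /flattenP[_ /mapP[u uE ->]].
by rewrite mem_nseq => /andP[_ /eqP->]; exact: h.
Qed.

Lemma sum_refine E : \sum_(u <- refine E) u = \sum_(u <- E) u.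
Proof.
elim: E => [|u E IH]; first by rewrite /refine !big_nil.
rewrite refine_cons big_cat /= IH big_cons; congr (_ + _).
rewrite big_nseq [RHS]primdivK.
move: (primdiv u) (lattice_length u) => v k; elim: k => [|k IHk]; first by rewrite !mul0r.
by rewrite iterS IHk /= intS !mulrDl !mul1r.
Qed.

Lemma valid_refine E F : valid E F -> valid (refine E) (refine F).
Proof.
case=> pE pF s; split; rewrite ?sum_refine//; apply: all_refine => u uE;
  apply: pos_primdiv; [exact: (allP pE)|exact: (allP pF)].
Qed.

Lemma prim_complement u : prim u -> exists w, det u w = 1.
Proof.
move=> /eqP gu; have [a [b ab]] := Bezoutz u.1 u.2.
exists (- b, a); rewrite /det /= mulrN opprK [u.1 * a]mulrC [u.2 * b]mulrC ab.
by rewrite /gcdz -[gcdn _ _]/(lattice_length u) gu.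
Qed.

Lemma det_coords u w v : det u w = 1 ->
  v = (det v w * u.1 + det u v * w.1, det v w * u.2 + det u v * w.2).
Proof.
move=> uw; rewrite [LHS]surjective_pairing; congr pair.
  by rewrite -[LHS]mulr1 -uw /det; ring.
by rewrite -[LHS]mulr1 -uw /det; ring.
Qed.

Lemma prim_multiple u w v : det u w = 1 -> lexpos u -> lexpos v -> prim v ->
  det u v = 0 -> v = u.
Proof.
move=> uw pu pv /eqP gv uv; have := det_coords v uw; rewrite uv !mul0r !addr0.
move: (det v w) => c Ev; move: gv pv;
  rewrite Ev /lattice_length /lexpos /= !abszM -muln_gcdr => /eqP.
rewrite muln_eq1 => /andP[/eqP c1 _].
have [->|->] : c = 1 \/ c = - 1 by lia.
  by rewrite !mul1r -surjective_pairing.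
by move: pu; rewrite /lexpos !mulN1r; lia.
Qed.

Section Widths.
Context {R : realType}.
Implicit Types (n m : R * R) (u v w p : int * int) (E F G : seq (int * int)).

Lemma zon_refine n E : all lexpos E -> zon n (refine E) = zon n E.
Proof.
elim: E => [|u E IH] //= /andP[pu pE].
rewrite refine_cons zon_cat zon_cons IH//; congr (_ + _).
have -> : emb u = ((lattice_length u)%:R * (emb (primdiv u)).1, (lattice_length u)%:R * (emb (primdiv u)).2) :> R * R.
  by rewrite {1}(primdivK u) /emb /= !intrM -!pmulrn.
rewrite /zon big_nseq.
have -> : dot n ((lattice_length u)%:R * (emb (primdiv u)).1, (lattice_length u)%:R * (emb (primdiv u)).2)
   = (lattice_length u)%:R * dot n (emb (primdiv u)) by rewrite /dot /=; ring.
rewrite -[0 in RHS](mulr0 (lattice_length u)%:R) -maxr_pMr ?ler0n//.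
by rewrite mulr_natl; elim: (lattice_length u) => // k IHk; rewrite iterS IHk mulrS.
Qed.

Lemma polygon_refine p E F : valid E F ->
  @polygon R p (refine E) (refine F) = polygon p E F.
Proof.
move=> [pE pF _]; apply/seteqP.
by split=> z h n; have := h n; rewrite /suppf !zon_refine.
Qed.

Definition absum n E : R := \sum_(u <- E) `|dot n (emb u)|.

Lemma zon_absum n E : 2 * zon n E = dot n (emb (\sum_(u <- E) u)) + absum n E.
Proof.
rewrite dot_sum /zon /absum mulr_sumr -big_split /=; apply: eq_bigr => u _.
by case: ltrP => h; [rewrite ger0_norm ?ltW//|rewrite ler0_norm//]; lra.
Qed.

(** Since 2 max(0, t) = t + |t|, the oriented parts cancel between n and - n. The result no longer
    refers to the lexicographic orientation, so it can be compared across bases. *)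
Lemma width_absum p E F n : valid E F ->
  2 * (suppf p E F n + suppf p E F (- n)) = absum n (E ++ F).
Proof.
move=> [pE pF EF].
have aN G : absum (- n) G = absum n G by apply: eq_bigr => u _; rewrite dotNl normrN.
have h1 := zon_absum n E; have h2 := zon_absum n F.
have h3 := zon_absum (- n) E; have h4 := zon_absum (- n) F.
rewrite !aN !dotNl EF in h1 h2 h3 h4.
rewrite /absum big_cat /= -/(absum n E) -/(absum n F) /suppf dotNl /= oppr_le0.
case: ifPn => n2; case: ifPn => n2'; try lra.
have n20 : n.2 = 0 by apply/le_anti; rewrite n2 n2'.
have : zon n E = zon n F by rewrite !zon_horizontal ?EF.
lra.
Qed.

(** For small e an edge not orthogonal to n keeps the sign of its product, so its term is affine in
    e and drops out; an orthogonal edge contributes e times its product with m, in absolute value,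
    on both sides. *)
Lemma second_difference G n m : exists2 e0, 0 < e0 &
  forall e, 0 <= e -> e <= e0 ->
    absum (n.1 + e * m.1, n.2 + e * m.2) G + absum (n.1 - e * m.1, n.2 - e * m.2) G
    - 2 * absum n G = 2 * e * \sum_(u <- G | dot n (emb u) == 0) `|dot m (emb u)|.
Proof.
have [|e0 e0p he] := @small_eps R _ [seq u <- G | dot n (emb u) != 0]
    (fun u => `|dot n (emb u)|) (fun u => dot m (emb u)).
  by move=> u; rewrite mem_filter normr_gt0 => /andP[].
exists e0 => // e ep ee;
  rewrite [in RHS]big_mkcond /absum !mulr_sumr -big_split -sumrB /=.
rewrite !big_seq; apply: eq_bigr => u uG.
have E1 : dot (n.1 + e * m.1, n.2 + e * m.2) (emb u) = dot n (emb u) + e * dot m (emb u).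
  by rewrite /dot /=; ring.
have E2 : dot (n.1 - e * m.1, n.2 - e * m.2) (emb u) = dot n (emb u) - e * dot m (emb u).
  by rewrite /dot /=; ring.
rewrite E1 E2; case: ifPn => [/eqP->|nu].
  by rewrite add0r sub0r normrN normr0 normrM (ger0_norm ep); ring.
have : u \in [seq u <- G | dot n (emb u) != 0] by rewrite mem_filter nu.
move=> /(he e ep ee); rewrite -{1}(ger0_norm ep) -normrM mulr0.
move: (dot n (emb u)) (e * dot m (emb u)) => a b.
by case: (ger0P a) => ha; case: (ger0P b) => hb; case: (ger0P (a + b)) => h3;
  case: (ger0P (a - b)) => h4; lra.
Qed.

(* Second differences of [absum] at [n] see only the edges orthogonal to [n], so
   [absum] determines the total length of the edges in each direction. *)
Lemma absum_transfer G G' (T : R * R -> R * R) :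
  (forall n m e, T (n.1 + e * m.1, n.2 + e * m.2) =
     ((T n).1 + e * (T m).1, (T n).2 + e * (T m).2)) ->
  (forall n, absum n G = absum (T n) G') -> forall n m,
  \sum_(u <- G | dot n (emb u) == 0) `|dot m (emb u)|
  = \sum_(u <- G' | dot (T n) (emb u) == 0) `|dot (T m) (emb u)|.
Proof.
move=> linT h n m.
have [e0 e0p he0] := second_difference G n m.
have [e1 e1p he1] := second_difference G' (T n) (T m).
pose e := Num.min e0 e1; have ep : 0 < e by rewrite lt_min e0p.
have := he0 e (ltW ep); rewrite ge_min lexx => /(_ isT).
have := he1 e (ltW ep); rewrite ge_min lexx orbT => /(_ isT).
have linT' : T (n.1 - e * m.1, n.2 - e * m.2) = ((T n).1 - e * (T m).1, (T n).2 - e * (T m).2).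
  by have := linT n m (- e); rewrite !mulNr.
move=> h1 h2; apply: (@mulfI _ (2 * e)); first by rewrite mulf_neq0// gt_eqF.
by rewrite -h1 -h2 !h linT linT'.
Qed.

End Widths.

(** * Lattices in V *)

Section Frames.
Context {R : realType} {V : vectType R}.
Implicit Types (f g v : V) (n z : R * R) (p : int * int) (E F : seq (int * int)).
Implicit Types (L P S : set V).
Local Notation edges := (@edges R).
Local Notation polygon := (@polygon R).

Definition pt f g z : V := z.1 *: f + z.2 *: g.

Definition lat f g : set V := [set v | exists a, v = pt f g (emb a)].

Definition frame f g : bool := basis_of {:V} [:: f; g].

Lemma ptD f g x y : pt f g (x + y) = pt f g x + pt f g y.
Proof. by rewrite /pt /= !scalerDl addrACA. Qed.

Lemma ptN f g x : pt f g (- x) = - pt f g x.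
Proof. by rewrite /pt /= !scaleNr opprD. Qed.

Lemma ptB f g x y : pt f g (x - y) = pt f g x - pt f g y.
Proof. by rewrite ptD ptN. Qed.

Lemma pt0 f g : pt f g 0 = 0.
Proof. by rewrite /pt !scale0r addr0. Qed.

Lemma pt_comb f g t x y : pt f g (comb t x y) = t *: pt f g x + (1 - t) *: pt f g y.
Proof. by rewrite /pt /comb /= !scalerDr !scalerA addrACA -!scalerDl. Qed.

Lemma frame_coord f g : frame f g -> forall v, exists z, v = pt f g z.
Proof.
move=> fg v; have := coord_basis (X := [tuple f; g]) fg (memvf v).
rewrite big_ord_recl big_ord1 /= => ->.
by exists (coord [tuple f; g] ord0 v, coord [tuple f; g] (lift ord0 ord0) v).
Qed.

Lemma frame_inj f g : frame f g -> injective (pt f g).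
Proof.
move=> /basis_free fg x y xy; apply/eqP; rewrite -subr_eq0; apply/eqP.
have : pt f g (x - y) = 0 by rewrite ptB xy subrr.
have /freeP/(_ (fun i => if i == ord0 then (x - y).1 else (x - y).2)) : free [tuple f; g] by [].
rewrite big_ord_recl big_ord1 /= => h /h {}h.
by have := h ord0; have := h (lift ord0 ord0) => /= h2 h1;
  rewrite [LHS]surjective_pairing /= h1 h2.
Qed.

Lemma frame_change f g x y : frame f g -> cross x y != 0 ->
  frame (pt f g x) (pt f g y).
Proof.
move=> fg xy; rewrite /frame basisEdim.
have := fg; rewrite /frame basisEdim => /andP[sp ->]; rewrite andbT.
apply: subv_trans sp _; apply/span_subvP => v.
set U := <<_>>%VS; have g0 : pt f g x \in U by rewrite memv_span ?mem_head.
have g1 : pt f g y \in U by rewrite memv_span// !inE eqxx orbT.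
rewrite !inE => /orP[]/eqP->.
  suff <- : (y.2 / cross x y) *: pt f g x - (x.2 / cross x y) *: pt f g y = f.
    by rewrite rpredB// memvZ.
  rewrite /pt !scalerDr !scalerA opprD addrACA -!scalerBl.
  have -> : y.2 / cross x y * x.1 - x.2 / cross x y * y.1 = 1.
    by rewrite /cross in xy *; field.
  have -> : y.2 / cross x y * x.2 - x.2 / cross x y * y.2 = 0 by rewrite mulrAC [x.2 / _ * _]mulrAC [y.2 * _]mulrC subrr.
  by rewrite scale1r scale0r addr0.
suff <- : (x.1 / cross x y) *: pt f g y - (y.1 / cross x y) *: pt f g x = g.
  by rewrite rpredB// memvZ.
rewrite /pt !scalerDr !scalerA opprD addrACA -!scalerBl.
have -> : x.1 / cross x y * y.1 - y.1 / cross x y * x.1 = 0.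
  by rewrite mulrAC [y.1 / _ * _]mulrAC [y.1 * _]mulrC subrr.
have -> : x.1 / cross x y * y.2 - y.1 / cross x y * x.2 = 1.
  by rewrite /cross in xy *; field.
by rewrite scale1r scale0r add0r.
Qed.

Lemma is_latticeP (hV : \dim {:V} = 2%N) L : is_lattice L <->
  exists f g, frame f g /\ L = lat f g.
Proof.
rewrite /is_lattice hV.
have spanE (b : 2.-tuple V) v : inIntSpan b v <-> lat b`_0 b`_1 v.
  rewrite /inIntSpan /lat /pt /=; split.
    move=> [a ->]; exists (a ord0, a (lift ord0 ord0)).
    by rewrite big_ord_recl big_ord1 /= !scaler_int.
  move=> [a ->]; exists [ffun i => if i == ord0 then a.1 else a.2].
  by rewrite big_ord_recl big_ord1 /= !ffunE /= !scaler_int.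
split=> [[b bb ->]|[f [g [fg ->]]]].
  exists b`_0, b`_1; split.
    by case: b bb => -[|a [|c [|]]].
  by apply/seteqP; split=> v /= /spanE.
exists [tuple f; g] => //; apply/seteqP.
by split=> v h; apply/(spanE [tuple f; g]).
Qed.

Lemma convex_setE S : @convex_set R V S <->
  forall t x y, 0 <= t -> t <= 1 -> S x -> S y -> S (t *: x + (1 - t) *: y).
Proof.
split=> [cS t x y t0 t1 Sx Sy|h x y l].
  have := cS x y (Itv01 t0 t1); rewrite !inE => /(_ Sx Sy).
  by [].
by rewrite !inE => Sx Sy; apply: (h l%:num).
Qed.

Lemma convex_hull_pt f g A p E F : frame f g -> edges A p E F ->
  convex_hull [set pt f g (emb a) | a in [set` A]] = pt f g @` polygon p E F.
Proof.
move=> fg hA; apply/seteqP; split.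
  apply: smallest_sub.
    apply/convex_setE => t _ _ t0 t1 [x Kx <-] [y Ky <-].
    by exists (comb t x y); [exact: polygon_convex|rewrite pt_comb].
  by move=> _ [a aA <-]; exists (emb a) => //; exact: edges_in hA aA.
move=> _ [z Kz <-] C [/convex_setE cC AC].
apply: (polygon_min (C := [set z | C (pt f g z)]) hA _ _ Kz).
  by move=> t x y t0 t1 Cx Cy; rewrite /= pt_comb; exact: cC.
by move=> a aA; apply: AC; exists a.
Qed.

Lemma lattice_polytopeP f g P : frame f g -> lattice_polytope (lat f g) P <->
  exists p E F, valid E F /\ P = pt f g @` polygon p E F.
Proof.
move=> fg; split=> [[S [finS S0 SL ->]]|[p [E [F [v ->]]]]].
  have [A SA] : exists A : seq (int * int), S = [set pt f g (emb a) | a in [set` A]].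
    have /finite_seqP[s Ss] := finS.
    have : forall v, v \in s -> lat f g v by move=> v vs; apply: SL; rewrite Ss.
    rewrite Ss; elim: s {Ss} => [|v s IH] h; first by exists [::]; apply/seteqP;
      split=> // v [].
    have [|A hA] := IH; first by move=> w ws; apply: h; rewrite inE ws orbT.
    have [a ha] := h v (mem_head _ _); exists (a :: A).
    apply/seteqP; split=> w.
      rewrite /= inE => /orP[/eqP->|ws]; first by exists a; rewrite //= mem_head.
      have : [set` s] w by [].
      by rewrite hA => -[b bA <-]; exists b; rewrite //= inE bA orbT.
    move=> [b /=]; rewrite inE => /orP[/eqP->|bA] <-; first by rewrite -ha mem_head.
    suff : [set` s] (pt f g (emb b)) by rewrite /= inE => ->; rewrite orbT.
    by rewrite hA; exists b.
  have A0 : A != [::] by apply: contraPneq S0 => A0; rewrite SA A0 => -[v []].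
  have [p [E [F hA]]] := @edges_exist R A A0.
  by exists p, E, F; split; [exact: hA.1|rewrite SA; exact: convex_hull_pt].
have [A hA] := @edges_realize R p E F v.
exists [set pt f g (emb a) | a in [set` A]]; split.
- by apply: finite_image; exact: finite_seq.
- by have [_ [a aA _]] := hA.2 0; exists (pt f g (emb a)); exists a.
- by move=> _ [a _ <-]; exists a.
- by rewrite (convex_hull_pt fg hA).
Qed.

Lemma card_pick f g p E F : frame f g -> valid E F ->
  pairwise slope E -> pairwise slope F ->
  2 * (#|` fset_set ((pt f g @` polygon p E F) `&` lat f g)|)%:Z
  = 2 + perimeter E + perimeter F + twarea E F.
Proof.
move=> fg v sE sF; have [s [us sK <-]] := @pick_theorem R p E F v sE sF.
have -> : (pt f g @` polygon p E F) `&` lat f g = [set` map (pt f g \o emb) s].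
  apply/seteqP; split=> [_ [[z Kz <-] [a /(frame_inj fg) za]]|].
    by apply/mapP; exists a; rewrite ?za//; apply/sK; rewrite -za.
  move=> _ /= /mapP[a /sK Ka ->]; split; first by exists (emb a).
  by exists a.
congr (2 * _%:Z); rewrite -(size_map (pt f g \o emb)).
have us' : uniq (map (pt f g \o emb) s).
  by rewrite map_inj_uniq// => a b /= /(frame_inj fg)/emb_inj.
by rewrite (_ : [set` _] = [set` [fset x in map (pt f g \o emb) s]%fset]) ?set_fsetK ?card_fseq ?undup_id//;
  apply/seteqP; split=> x /=; rewrite in_fset.
Qed.

End Frames.

(** * Area *)

Section PlaneMeasure.
Context {R : realType}.
Local Notation mu := (@lebesgue_measure R).
Local Notation T2 := (measurableTypeR R * measurableTypeR R)%type.
Local Notation mu2 := ((mu \x mu)%E : set T2 -> \bar R).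
Local Notation polygon := (@polygon R).

Lemma measurable_affine (k t : R) :
  measurable_fun setT (fun x : measurableTypeR R => k * x + t : measurableTypeR R).
Proof. by apply: measurable_funD => //; exact: mulrl_measurable. Qed.

(** The left-hand side is again a measure in A, and it agrees with Lebesgue measure on half-open
    intervals, so uniqueness applies. *)
Lemma lebesgue_measure_affine (k t : R) (A : set (measurableTypeR R)) :
  0 < k -> measurable A ->
  (k%:E * mu ((fun x => (k * x + t)%R : measurableTypeR R) @^-1` A) = mu A)%E.
Proof.
move=> k0 mA; pose k' : {nonneg R} := NngNum (ltW k0).
pose f (x : measurableTypeR R) : measurableTypeR R := k * x + t.
have mf : measurable_fun setT f := measurable_affine k t.
pose m := measure_function_mscale__canonical__measure_function_Measure k'
  (measure_function_pushforward__canonical__measure_function_Measure mu mf).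
rewrite -[LHS]/(m A); apply/esym.
apply: (lebesgue_measure_unique (mu := m)) => // _ [[a b]] _ <-;
  rewrite -[RHS]/(k%:E * mu (f @^-1` `]a, b]))%E.
have -> : f @^-1` `]a, b] = `](a - t) / k, (b - t) / k]%classic.
  apply/seteqP; split=> x; rewrite /f /= !in_itv /= ltr_pdivrMr// ler_pdivlMr//.
    by rewrite ltrBlDr lerBrDr [x * k]mulrC.
  by rewrite ltrBlDr lerBrDr [x * k]mulrC.
rewrite !lebesgue_measure_itv/= !lte_fin ltr_pM2r ?invr_gt0// ltrD2r.
case: ifPn => _; last by rewrite mule0.
by rewrite -!EFinB -EFinM; congr (_%:E); field; rewrite gt_eqF.
Qed.

Lemma plane_measure_affine (k t1 t2 : R) (A : set T2) : 0 < k -> measurable A ->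
  ((k ^+ 2)%:E * mu2 [set c | A ((k * c.1 + t1)%R, (k * c.2 + t2)%R)] = mu2 A)%E.
Proof.
move=> k0 mA; pose k' : {nonneg R} := NngNum (exprn_ge0 2 (ltW k0)).
pose f (c : T2) : T2 := (k * c.1 + t1, k * c.2 + t2).
have mf : measurable_fun setT f.
  by apply: measurable_fun_pair => /=;
    [apply: (measurableT_comp (measurable_affine k t1)) | apply: (measurableT_comp (measurable_affine k t2))].
pose m := measure_function_mscale__canonical__measure_function_Measure k'
  (measure_function_pushforward__canonical__measure_function_Measure mu2 mf).
rewrite -[LHS]/(m A); apply/esym.
apply: (product_measure_unique (m' := m)) => // B C mB mC.
rewrite -[LHS]/((k ^+ 2)%:E * mu2 (f @^-1` (B `*` C)))%E.
have -> : f @^-1` (B `*` C) = ((fun x => k * x + t1 : measurableTypeR R) @^-1` B)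
   `*` ((fun x => k * x + t2 : measurableTypeR R) @^-1` C) by [].
rewrite product_measure1E.
- transitivity (mu B * mu C)%E; last by [].
  rewrite expr2 EFinM -(lebesgue_measure_affine t1 k0 mB) -(lebesgue_measure_affine t2 k0 mC).
  by rewrite -!muleA; congr (_ * _)%E; rewrite muleCA.
- by rewrite -[X in measurable X]setTI; exact: measurable_affine.
- by rewrite -[X in measurable X]setTI; exact: measurable_affine.
Qed.

Lemma size_packing (I : choiceType) (s : seq I) (F : I -> set T2) (A : set T2) (r : R) :
  uniq s -> measurable A -> (forall i, i \in s -> measurable (F i)) ->
  trivIset [set` s] F -> (forall i, i \in s -> F i `<=` A) ->
  (forall i, i \in s -> mu2 (F i) = r%:E) -> (((size s)%:R * r)%:E <= mu2 A)%E.
Proof.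
move=> us mA mF tF FA Fx.
have mU : measurable (\bigcup_(i in [set` s]) F i) by apply: fin_bigcup_measurable.
have : (mu2 (\bigcup_(i in [set` s]) F i) <= mu2 A)%E.
  by apply: le_measure; rewrite ?inE// => c [i /= si]; exact: FA.
rewrite measure_fin_bigcup// -fsbig_seq// (eq_big_seq (fun=> r%:E))//.
by rewrite sumEFin big_const_seq count_predT iter_addr_0 mulr_natl.
Qed.

Lemma size_covering (I : choiceType) (s : seq I) (F : I -> set T2) (A : set T2) (r : R) :
  uniq s -> measurable A -> (forall i, i \in s -> measurable (F i)) ->
  A `<=` \bigcup_(i in [set` s]) F i ->
  (forall i, i \in s -> mu2 (F i) = r%:E) -> (mu2 A <= ((size s)%:R * r)%:E)%E.
Proof.
move=> us mA mF AF Fx.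
apply: le_trans (content_sub_fsum _ _ _ mA AF) _ => //.
rewrite -fsbig_seq// (eq_big_seq (fun=> r%:E))//.
by rewrite sumEFin big_const_seq count_predT iter_addr_0 mulr_natl.
Qed.

Lemma measurable_sublevel (a b t : R) : measurable [set c : T2 | a * c.1 + b * c.2 <= t].
Proof.
pose f (c : T2) : measurableTypeR R := a * c.1 + b * c.2.
have mf : measurable_fun setT f.
  apply: measurable_funD.
    exact: (measurableT_comp (mulrl_measurable (D := setT) a) (measurable_fst)).
  exact: (measurableT_comp (mulrl_measurable (D := setT) b) (measurable_snd)).
have := mf measurableT `]-oo, t]%classic (measurable_itv _).
by rewrite setTI.
Qed.

Section LinearCoordinates.
Context (x y : R * R).
Context (xy : cross x y != 0).

(** Here x and y stand for the lattice coordinates of the basis that normalizes the area; [ell]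
    converts coordinates in that basis to lattice coordinates, so [nu] is the area of a set given in
    lattice coordinates. *)
Definition ell (c : T2) : R * R := (c.1 * x.1 + c.2 * y.1, c.1 * x.2 + c.2 * y.2).

Definition nu (S : set (R * R)) : \bar R := mu2 [set c | S (ell c)].

Definition cmeasurable (S : set (R * R)) : Prop := measurable [set c : T2 | S (ell c)].

Lemma ell_surj w : exists d, ell d = w.
Proof.
exists (cross w y / cross x y, cross x w / cross x y).
rewrite /ell /=; apply/eqP; have := xy; rewrite /cross => xy'; case: w => a b /=.
by rewrite xpair_eqE; apply/andP; split; apply/eqP; field.
Qed.

Lemma ell_affine k w (S : set (R * R)) : exists t1 t2,
  [set c | S (k * (ell c).1 + w.1, k * (ell c).2 + w.2)] =
  [set c : T2 | [set c' | S (ell c')] ((k * c.1 + t1)%R, (k * c.2 + t2)%R)].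
Proof.
have [[d1 d2] <-] := ell_surj w; exists d1, d2; apply/seteqP.
by split=> c; rewrite /= /ell /=; congr S; congr pair; ring.
Qed.

Lemma cmeasurable_affine k w (S : set (R * R)) : cmeasurable S ->
  cmeasurable [set z | S (k * z.1 + w.1, k * z.2 + w.2)].
Proof.
move=> mS; rewrite /cmeasurable; have [t1 [t2 ->]] := ell_affine k w S.
have mf : measurable_fun setT (fun c : T2 => (k * c.1 + t1, k * c.2 + t2) : T2).
  by apply: measurable_fun_pair => /=;
    [apply: (measurableT_comp (measurable_affine k t1)) | apply: (measurableT_comp (measurable_affine k t2))].
by have := mf measurableT _ mS; rewrite setTI.
Qed.

Lemma nu_affine k w (S : set (R * R)) : 0 < k -> cmeasurable S ->
  ((k ^+ 2)%:E * nu [set z | S ((k * z.1 + w.1)%R, (k * z.2 + w.2)%R)] = nu S)%E.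
Proof.
move=> k0 mS; rewrite /nu; have [t1 [t2 ->]] := ell_affine k w S.
exact: plane_measure_affine.
Qed.

Lemma cmeasurable_halfplane n t : cmeasurable [set z | dot n z <= t].
Proof.
rewrite /cmeasurable (_ : [set c | _] = [set c : T2 | dot n x * c.1 + dot n y * c.2 <= t]).
  exact: measurable_sublevel.
apply/seteqP; split=> c; rewrite /= /ell /dot /=; congr (_ <= _); ring.
Qed.

Lemma cmeasurable_halfplaneC n t : cmeasurable [set z | t < dot n z].
Proof.
have := measurableC (cmeasurable_halfplane n t); congr measurable.
by apply/seteqP; split=> c /=; rewrite ltNge => /negP.
Qed.

(** The defining intersection runs over uncountably many normals. Rational normals suffice, with
    each support value written as a maximum over finitely many points. *)
Lemma cmeasurable_polygon p E F : valid E F -> cmeasurable (polygon p E F).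
Proof.
move=> v; have [A hA] := @edges_realize R p E F v.
rewrite /cmeasurable (_ : [set c | _] = \bigcap_(q in [set: rat * rat])
   \bigcup_(a in [set` A]) [set c : T2 | dot (ratr q.1, ratr q.2) (ell c)
                                        <= dot (ratr q.1, ratr q.2) (emb a)]).
  rewrite -[X in measurable X]setCK setC_bigcap; apply: measurableC.
  rewrite bigcup_mkcond; apply: countable_bigcupT_measurable; first exact: countableP.
  move=> q; rewrite in_setT; apply: measurableC; apply: fin_bigcup_measurable => // a _.
  exact: cmeasurable_halfplane.
apply/seteqP; split=> c /=.
  by move/(polygon_edges _ hA) => h q _; have [a aA ha] := h (ratr q.1, ratr q.2);
    exists a.
move=> h; apply/(polygon_edges _ hA) => n; apply: contrapT => nex.
pose z := ell c.
have pos_all a : a \in A -> 0 < dot n (z - emb a).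
  move=> aA; rewrite dotBr subr_gt0 ltNge; apply/negP => ha.
  by apply: nex; exists a.
(* A normal n that separates z strictly from the finite set A does so with a margin, so a rational
   normal within eps of n in both coordinates still separates. *)
have [eps e0 he] := @small_eps R _ A (fun a => dot n (z - emb a))
   (fun a => `|(z - emb a).1| + `|(z - emb a).2|) pos_all.
have n1e : n.1 < n.1 + eps by rewrite ltrDl.
have n2e : n.2 < n.2 + eps by rewrite ltrDl.
have [q1] := rat_in_itvoo n1e; rewrite in_itv /= => /andP[q1l q1r].
have [q2] := rat_in_itvoo n2e; rewrite in_itv /= => /andP[q2l q2r].
have [a aA] := h (q1, q2) I; apply/negP; rewrite -ltNge -subr_gt0 -dotBr -/z.
have := he eps (ltW e0) (lexx _) a aA; rewrite ger0_norm ?addr_ge0//.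
have := ler_norm (- (z - emb a).1); have := ler_norm (- (z - emb a).2).
rewrite !normrN /dot /=; move: (z.1 - _) (z.2 - _) => X Y hY hX hXY.
have : (ratr q1 - n.1) * - X <= eps * `|X|.
  apply: le_trans (_ : (ratr q1 - n.1) * `|X| <= _);
    first by rewrite ler_wpM2l// subr_ge0 ltW.
  by rewrite ler_wpM2r//; lra.
have : (ratr q2 - n.2) * - Y <= eps * `|Y|.
  apply: le_trans (_ : (ratr q2 - n.2) * `|Y| <= _);
    first by rewrite ler_wpM2l// subr_ge0 ltW.
  by rewrite ler_wpM2r//; lra.
lra.
Qed.

Definition box : set (R * R) := [set z | 0 <= z.1 < 1 /\ 0 <= z.2 < 1].

Lemma cmeasurable_box : cmeasurable box.
Proof.
rewrite /cmeasurable (_ : [set c | _] = [set c : T2 | dot (-1, 0) (ell c) <= 0] `&`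
    [set c : T2 | dot (0, -1) (ell c) <= 0] `&`
    [set c : T2 | -1 < dot (-1, 0) (ell c)] `&` [set c : T2 | -1 < dot (0, -1) (ell c)]).
  by do !apply: measurableI; rewrite -/(cmeasurable _);
    [exact: (cmeasurable_halfplane (-1,0) 0) |
    exact: (cmeasurable_halfplane (0,-1) 0)|exact: (cmeasurable_halfplaneC (-1,0) (-1))|exact: (cmeasurable_halfplaneC (0,-1) (-1))].
apply/seteqP; split=> c; rewrite /box /dot /=; move: (ell c) => z;
  rewrite !mul0r !addr0 !add0r !mulN1r !oppr_le0 !ltrN2.
  by move=> [/andP[? ?] /andP[? ?]].
by move=> [[[? ?] ?] ?]; split; apply/andP.
Qed.

Lemma nu_box_fin : (nu box < +oo)%E.
Proof.
pose M := (`|x.1| + `|x.2| + `|y.1| + `|y.2|) / `|cross x y|.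
have xy0 : 0 < `|cross x y| by rewrite normr_gt0.
have mI : measurable (`[- M, M]%classic : set (measurableTypeR R)) by exact: measurable_itv.
have sub : [set c : T2 | box (ell c)] `<=` `[- M, M]%classic `*` `[- M, M]%classic.
  move=> c [/andP[a0 a1] /andP[b0 b1]].
  have E1 : c.1 * cross x y = (ell c).1 * y.2 - (ell c).2 * y.1 by rewrite /cross /ell /=; ring.
  have E2 : c.2 * cross x y = (ell c).2 * x.1 - (ell c).1 * x.2 by rewrite /cross /ell /=; ring.
  have bnd a b u v : 0 <= a -> a < 1 -> 0 <= b -> b < 1 ->
    `|a * u - b * v| <= `|u| + `|v| :> R.
    move=> *; apply: le_trans (ler_normB _ _) _; rewrite !normrM lerD//.
      by rewrite ger0_norm// ler_piMl// ltW.
    by rewrite ger0_norm// ler_piMl// ltW.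
  rewrite /= !in_itv /= -!ler_norml /M !ler_pdivlMr// -!normrM E1 E2; split.
    apply: le_trans (bnd _ _ _ _ a0 a1 b0 b1) _; have := normr_ge0 x.1; have :=
      normr_ge0 x.2; lra.
  apply: le_trans (bnd _ _ _ _ b0 b1 a0 a1) _; have := normr_ge0 y.1; have :=
    normr_ge0 y.2; lra.
apply: (@le_lt_trans _ _ (mu2 (`[- M, M]%classic `*` `[- M, M]%classic))).
  by apply: le_measure => //; rewrite inE; [exact: cmeasurable_box|exact: measurableX].
rewrite product_measure1E//= lebesgue_measure_itv /=.
by case: ifP => _; rewrite ?mule0 -?EFinB -?EFinM ltry.
Qed.

Lemma nu_box_gt0 : (0 < nu box)%E.
Proof.
pose S := `|x.1| + `|x.2| + `|y.1| + `|y.2|.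
have S0 : 0 <= S by rewrite !addr_ge0.
(* Moving both coordinates by at most eps moves [ell] by less than 1/2 in each coordinate, so a
   square of side eps at the preimage of the centre stays in the box. *)
pose eps := (2 * (S + 1))^-1; have e0 : 0 < eps by rewrite invr_gt0; lra.
have eS : eps * S < 2^-1.
  by rewrite /eps mulrC ltr_pdivrMr; lra.
have [d hd] := ell_surj (2^-1, 2^-1).
have mI a : measurable (`[a, a + eps]%classic : set (measurableTypeR R)) by exact: measurable_itv.
have sub : `[d.1, d.1 + eps]%classic `*` `[d.2, d.2 + eps]%classic `<=` [set c : T2 | box (ell c)].
  move=> c [/=]; rewrite !in_itv /= => /andP[a0 a1] /andP[b0 b1].
  have bnd u v : - (eps * (`|u| + `|v|)) <= (c.1 - d.1) * u + (c.2 - d.2) * v <= eps * (`|u| + `|v|).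
    rewrite -ler_norml; apply: le_trans (ler_normD _ _) _; rewrite !normrM mulrDr lerD//.
      by rewrite ler_wpM2r// ger0_norm; lra.
    by rewrite ler_wpM2r// ger0_norm; lra.
  have nx1 := normr_ge0 x.1; have nx2 := normr_ge0 x.2.
  have ny1 := normr_ge0 y.1; have ny2 := normr_ge0 y.2.
  have h1 : eps * (`|x.1| + `|y.1|) <= eps * S by rewrite ler_pM2l// /S; lra.
  have h2 : eps * (`|x.2| + `|y.2|) <= eps * S by rewrite ler_pM2l// /S; lra.
  have := bnd x.1 y.1; have := bnd x.2 y.2.
  move: hd; rewrite /ell => -[hd1 hd2] /andP[l1 u1] /andP[l2 u2].
  rewrite /box /ell /=; split; apply/andP; split; lra.
apply: (@lt_le_trans _ _ (mu2 (`[d.1, d.1 + eps]%classic `*` `[d.2, d.2 + eps]%classic))).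
  rewrite product_measure1E//= !lebesgue_measure_itv /= !lte_fin !ltrDl e0.
  by rewrite -!EFinB -EFinM lte_fin ![_ + eps]addrC !addrK mulr_gt0.
by apply: le_measure => //; rewrite inE; [exact: measurableX|exact: cmeasurable_box].
Qed.

End LinearCoordinates.

End PlaneMeasure.

(** * Area as the leading coefficient of lattice point counts *)

Section AreaCount.
Context {R : realType}.
Implicit Types (w p : int * int) (E F : seq (int * int)).
Local Notation polygon := (@polygon R).

Lemma quadratic_bound (d a b : R) :
  (forall k : nat, (0 < k)%N -> d * k%:R ^+ 2 <= a * k%:R + b) -> d <= 0.
Proof.
move=> h; rewrite leNgt; apply/negP => d0.
have x0 : 0 <= (`|a| + `|b|) / d by rewrite divr_ge0 ?addr_ge0// ltW.
have := archi_boundP x0; set n := Num.bound _; rewrite ltr_pdivrMr// => hn.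
have k1 : 1 <= n.+1%:R :> R by rewrite ler1n.
have nk : n%:R <= n.+1%:R :> R by rewrite ler_nat.
have := h n.+1 isT; move: (n.+1%:R) (n%:R) k1 nk hn => k m k1 mk hm.
have hk : `|a| + `|b| < d * k by apply: lt_le_trans hm _; rewrite mulrC ler_pM2l.
have h1 : (`|a| + `|b|) * k < d * k * k by rewrite ltr_pM2r//; lra.
have h2 : a * k <= `|a| * k by rewrite ler_wpM2r ?ler_norm//; lra.
have h3 : b <= `|b| * k by apply: le_trans (ler_norm b) _; rewrite ler_peMr.
rewrite expr2; lra.
Qed.

Definition dilated k p E F : set (R * R) :=
  polygon (dilate k k p) (map (dilate k k) E) (map (dilate k k) F).

Lemma dilatedE k p E F z : (0 < k)%N ->
  dilated k p E F z <-> forall n, dot n z <= k%:R * suppf p E F n.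
Proof.
move=> k0; have k0' : 0 < k%:R :> R by rewrite ltr0n.
have [h1 h2] := polygon_dilate p E F (z.1 / k%:R, z.2 / k%:R) k0 k0.
rewrite /dilated; have zE : z = (k%:R * (z.1 / k%:R), k%:R * (z.2 / k%:R)).
  by rewrite ![k%:R * _]mulrC !divfK ?gt_eqF// -surjective_pairing.
have dE n : dot n (z.1 / k%:R, z.2 / k%:R) = dot n z / k%:R.
  by rewrite /dot /= mulrDl !mulrA.
rewrite {1}zE; split=> [/h1 h n|h].
  by have := h n; rewrite dE ler_pdivrMr// mulrC.
by apply: h2 => n; rewrite dE ler_pdivrMr// mulrC.
Qed.

Lemma dilated_add k m p E F z z' : (0 < k)%N -> (0 < m)%N ->
  dilated k p E F z -> dilated m p E F z' -> dilated (k + m) p E F (z + z').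
Proof.
move=> k0 m0 /(dilatedE _ _ _ _ k0) h /(dilatedE _ _ _ _ m0) h'.
apply/dilatedE; first by rewrite addn_gt0 k0.
by move=> n; rewrite dotDr natrD mulrDl lerD.
Qed.

(** Some dilate contains a square of side 2 around a lattice point, which absorbs the size of a cell
    when lattice points and cells are compared. *)
Definition thick p E F : Prop := exists m w, (0 < m)%N /\
  forall s : R * R, `|s.1| <= 1 -> `|s.2| <= 1 -> dilated m p E F (emb w + s).

(** The centre is 3M times the centroid of the triangle, an integer point. Its slack in direction n
    is at least M max(|n.u|, |n.v|), and Cramer's rule with |det u v| >= 1 bounds |n.1| + |n.2| by
    the same quantity. *)
Lemma thick_noncollinear p E F (a0 a1 a2 : int * int) :
  polygon p E F (emb a0) -> polygon p E F (emb a1) -> polygon p E F (emb a2) ->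
  det (a1 - a0) (a2 - a0) != 0 -> thick p E F.
Proof.
move=> K0 K1 K2 d0; set u := a1 - a0 in d0; set v := a2 - a0 in d0.
pose M := (`|u.1| + `|u.2| + `|v.1| + `|v.2|)%N.
have M0 : (0 < M)%N.
  rewrite lt0n; apply: contra_neq d0 => /eqP; rewrite !addn_eq0 !absz_eq0.
  by move=> /andP[/andP[/andP[/eqP e1 /eqP e2] _] _]; rewrite /det e1 e2 !mul0r subrr.
exists (3 * M)%N, ((M%:Z * (a0 + a1 + a2).1), (M%:Z * (a0 + a1 + a2).2)).
split; first by rewrite muln_gt0.
move=> s s1 s2; apply/dilatedE; first by rewrite muln_gt0.
move=> n; have h0 := K0 n; have h1 := K1 n; have h2 := K2 n.
set h := suppf p E F n in h0 h1 h2 *.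
have -> : dot n (emb (M%:Z * (a0 + a1 + a2).1, M%:Z * (a0 + a1 + a2).2) + s) =
    M%:R * (dot n (emb a0) + dot n (emb a1) + dot n (emb a2)) + dot n s.
  by rewrite dotDr -!dotDr -!embD /dot /emb /= !intrM -!pmulrn; ring.
pose al := `|dot n (emb u)|; pose be := `|dot n (emb v)|.
have hal : al <= 3 * h - (dot n (emb a0) + dot n (emb a1) + dot n (emb a2)).
  by rewrite ler_norml /u embB dotBr; apply/andP; split; lra.
have hbe : be <= 3 * h - (dot n (emb a0) + dot n (emb a1) + dot n (emb a2)).
  by rewrite ler_norml /v embB dotBr; apply/andP; split; lra.
have d1 : 1 <= `|(det u v)%:~R : R|.
  by rewrite -intr_norm -[1](@mulr1z R) ler_int; move: d0; case: (det u v) => [[|k]|k].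
have n1E : n.1 * (det u v)%:~R = dot n (emb u) * (emb v).2 - dot n (emb v) * (emb u).2.
  by rewrite det_emb /dot; ring.
have n2E : n.2 * (det u v)%:~R = dot n (emb v) * (emb u).1 - dot n (emb u) * (emb v).1.
  by rewrite det_emb /dot; ring.
have b1 : `|n.1| <= al * `|(emb v).2| + be * `|(emb u).2|.
  apply: le_trans (_ : `|n.1 * (det u v)%:~R| <= _); first by rewrite normrM ler_peMr.
  by rewrite n1E; apply: le_trans (ler_normB _ _) _; rewrite !normrM.
have b2 : `|n.2| <= be * `|(emb u).1| + al * `|(emb v).1|.
  apply: le_trans (_ : `|n.2 * (det u v)%:~R| <= _); first by rewrite normrM ler_peMr.
  by rewrite n2E; apply: le_trans (ler_normB _ _) _; rewrite !normrM.
have MR : M%:R = `|(emb u).1| + `|(emb u).2| + `|(emb v).1| + `|(emb v).2| :> R.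
  by rewrite /M !natrD /emb /= -!intr_norm -!abszE.
set D := 3 * h - _ in hal hbe.
have D0 : 0 <= D by apply: le_trans hal; exact: normr_ge0.
have hs : dot n s <= `|n.1| + `|n.2|.
  by rewrite /dot lerD//; apply: le_trans (ler_norm _) _; rewrite normrM ler_piMr.
have key : `|n.1| + `|n.2| <= D * M%:R.
  rewrite MR; have e1 := normr_ge0 (emb u : R * R).1; have e2 :=
    normr_ge0 (emb u : R * R).2.
  have e3 := normr_ge0 (emb v : R * R).1; have e4 := normr_ge0 (emb v : R * R).2.
  have mul b c : 0 <= c -> b <= D -> b * c <= D * c by move=> *; rewrite ler_wpM2r.
  have := mul _ _ e4 hal; have := mul _ _ e2 hbe; have := mul _ _ e1 hbe.
  have := mul _ _ e3 hal; lra.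
rewrite natrM /D in key *; lra.
Qed.

Section Tiles.
Context (x y : R * R).
Context (xy : cross x y != 0).

Definition tile (k : nat) (a : int * int) : set (R * R) :=
  [set z | box (k%:R * z.1 + (- emb a).1, k%:R * z.2 + (- emb a).2)].

Lemma cmeasurable_tile k a : cmeasurable x y (tile k a).
Proof. exact: (cmeasurable_affine xy k%:R (- emb a) (@cmeasurable_box R x y)). Qed.

Lemma nu_tile k a : (0 < k)%N -> nu x y (tile k a) = (fine (nu x y box) / k%:R ^+ 2)%:E.
Proof.
move=> k0; have k0' : 0 < k%:R :> R by rewrite ltr0n.
have := nu_affine xy (- emb a) k0' (@cmeasurable_box R x y); rewrite -/(tile k a).
have bf : nu x y box \is a fin_num by rewrite ge0_fin_numE ?nu_box_fin// ltW// nu_box_gt0.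
have k2 : 0 < k%:R ^+ 2 :> R by rewrite exprn_gt0.
move=> hk; transitivity (((k%:R ^+ 2)^-1)%:E * nu x y box)%E.
  by rewrite -hk muleA -EFinM mulVf ?mul1e// (gt_eqF k2).
by rewrite -(fineK bf) -EFinM mulrC.
Qed.

Lemma tile_norm k a z : tile k a z ->
  `|(emb a - (k%:R * z.1, k%:R * z.2)).1| <= 1 /\
  `|(emb a - (k%:R * z.1, k%:R * z.2)).2| <= 1.
Proof.
move=> [/= /andP[a1 a2] /andP[a3 a4]].
by split; rewrite distrC ger0_norm //; apply: ltW.
Qed.

Lemma tile_inj k a b z : tile k a z -> tile k b z -> a = b.
Proof.
move=> [/andP[a1 a2] /andP[a3 a4]] [/andP[b1 b2] /andP[b3 b4]].
have close (c d : int) (t : R) : 0 <= t + - c%:~R -> t + - c%:~R < 1 ->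
    0 <= t + - d%:~R -> t + - d%:~R < 1 -> c = d.
  move=> h1 h2 h3 h4.
  have l1 : (c%:~R : R) < (d + 1)%:~R by rewrite intrD; lra.
  have l2 : (d%:~R : R) < (c + 1)%:~R by rewrite intrD; lra.
  by move: l1 l2; rewrite !ltr_int !ltzD1 => l1 l2; apply/le_anti; rewrite l1 l2.
rewrite [a]surjective_pairing [b]surjective_pairing; congr pair.
  exact: close a1 a2 b1 b2.
exact: close a3 a4 b3 b4.
Qed.

Lemma tile_floor k z : tile k (Num.floor (k%:R * z.1), Num.floor (k%:R * z.2)) z.
Proof.
rewrite /tile /box /=.
have h (t : R) : 0 <= t + - (Num.floor t)%:~R < 1.
  by have /andP[h1] := floor_itv t; rewrite intrD subr_ge0 ltrBlDr => h2;
    rewrite h1 addrC.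
by split.
Qed.

Context (p : int * int) (E F : seq (int * int)).
Context (vEF : valid E F) (sE : pairwise slope E) (sF : pairwise slope F).

(** Twice the Ehrhart polynomial of the polygon. *)
Lemma dilated_count k : (0 < k)%N -> exists s : seq (int * int),
  [/\ uniq s, forall a, a \in s <-> dilated k p E F (emb a) &
    2 * (size s)%:R = 2 + k%:R * (perimeter E + perimeter F)%:~R
       + k%:R ^+ 2 * (twarea E F)%:~R :> R].
Proof.
move=> k0; have vk := valid_dilate k0 k0 vEF.
have [||s [us sK hs]] := @pick_theorem R (dilate k k p) _ _ vk; rewrite ?slope_dilate//.
exists s; split=> //; move: hs; rewrite !perimeter_dilate twarea_dilate.
move: (twarea E F) (perimeter E) (perimeter F) => T pe pf /(congr1 (fun i => i%:~R : R)).
by rewrite !intrD !intrM -!pmulrn natrM => ->; ring.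
Qed.

(** Packing: for a in kK, the cell of mesh 1/(k + m) at a + w lies in K, because its (k + m)-fold
    dilate lies in a + w + [0,1)^2, hence in kK + mK. *)
Lemma nu_lower k m w s : (0 < k)%N -> (0 < m)%N ->
  (forall z : R * R, `|z.1| <= 1 -> `|z.2| <= 1 -> dilated m p E F (emb w + z)) ->
  uniq s -> (forall a, a \in s <-> dilated k p E F (emb a)) ->
  (((size s)%:R * (fine (nu x y box) / (k + m)%:R ^+ 2))%:E <= nu x y (polygon p E F))%E.
Proof.
move=> k0 m0 hm us sK; have km0 : (0 < k + m)%N by rewrite addn_gt0 k0.
apply: (size_packing (F := fun a => [set c | tile (k + m) (a + w) (ell x y c)]) us).
- exact: cmeasurable_polygon.
- by move=> a _; exact: cmeasurable_tile.
- apply/trivIsetP => a b _ _ ab; apply/seteqP; split=> // c [/= ha hb].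
  by move/eqP: ab; apply; exact/(addIr w)/(tile_inj ha hb).
- move=> a /sK Ka c /= [/andP[a1 a2] /andP[a3 a4]].
  apply/(polygon_dilate _ _ _ _ km0 km0); rewrite -/(dilated _ _ _ _).
  pose z := ((k + m)%:R * (ell x y c).1 - (emb (a + w)).1, (k + m)%:R * (ell x y c).2 - (emb (a + w)).2).
  have -> : ((k + m)%:R * (ell x y c).1, (k + m)%:R * (ell x y c).2) = emb a + (emb w + z).
    by rewrite addrA -embD; congr pair; rewrite /z /=; ring.
  by apply: dilated_add => //; apply: hm; rewrite ger0_norm// ltW.
- by move=> a _; exact: nu_tile.
Qed.

(** Covering: for z in K the integral part f of kz satisfies f + w = kz + (w + (f - kz)), a point of
    kK + mK, so the cells of mesh 1/k at a - w with a in (k + m)K suffice. *)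
Lemma nu_upper k m w s : (0 < k)%N -> (0 < m)%N ->
  (forall z : R * R, `|z.1| <= 1 -> `|z.2| <= 1 -> dilated m p E F (emb w + z)) ->
  uniq s -> (forall a, a \in s <-> dilated (k + m) p E F (emb a)) ->
  (nu x y (polygon p E F) <= ((size s)%:R * (fine (nu x y box) / k%:R ^+ 2))%:E)%E.
Proof.
move=> k0 m0 hm us sK.
apply: (size_covering (F := fun a => [set c | tile k (a - w) (ell x y c)]) us).
- exact: cmeasurable_polygon.
- by move=> a _; exact: cmeasurable_tile.
- move=> c /= Kc; set z := ell x y c in Kc *.
  have := tile_floor k z; set f := (_, _) => hf; exists (f + w); last by rewrite /= addrK.
  apply/sK; have [f1 f2] := tile_norm hf.
  have -> : emb (f + w) = (k%:R * z.1, k%:R * z.2) + (emb w + (emb f - (k%:R * z.1, k%:R * z.2))).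
    by rewrite embD addrCA addrC; congr (_ + _); rewrite addrCA subrr addr0.
  apply: dilated_add => //; first exact/(polygon_dilate _ _ _ _ k0 k0).
  exact: hm.
- by move=> a _; exact: nu_tile.
Qed.

Lemma nu_polygon : thick p E F ->
  nu x y (polygon p E F) = (fine (nu x y box) / 2 * (twarea E F)%:~R)%:E.
Proof.
move=> [m [w [m0 hm]]].
have bf : nu x y box \is a fin_num by rewrite ge0_fin_numE ?nu_box_fin// ltW// nu_box_gt0.
have r0 : 0 < fine (nu x y box) by apply: fine_gt0; apply/andP; split;
  [exact: nu_box_gt0|exact: nu_box_fin].
have K0 : (0 <= nu x y (polygon p E F))%E by exact: measure_ge0.
have Kf : nu x y (polygon p E F) \is a fin_num.
  have [s [us sK _]] := dilated_count (ltn0Sn m : (0 < 1 + m)%N).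
  by rewrite ge0_fin_numE// (le_lt_trans (nu_upper (ltn0Sn 0) m0 hm us sK))// ltry.
move: Kf K0 nu_lower nu_upper dilated_count => Kf K0 lower upper count.
rewrite -(fineK Kf); congr (_%:E).
set N := nu x y (polygon p E F) in Kf K0 lower upper *; set r :=
  fine _ in r0 lower upper *.
pose P : R := (perimeter E + perimeter F)%:~R; pose T : R := (twarea E F)%:~R.
have low_bound (k : nat) : (0 < k)%N ->
    (2 + k%:R * P + k%:R ^+ 2 * T) * r <= 2 * ((k%:R + m%:R) ^+ 2 * fine N).
  move=> k0; have [s [us sK hs]] := count k k0.
  have := lower k m w s k0 m0 hm us sK;
    rewrite -(fineK Kf) lee_fin -hs mulrA natrD ler_pdivrMr.
    by rewrite -[2 * _ * r]mulrA ler_pM2l// [_ * fine N]mulrC.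
  by rewrite exprn_gt0// addr_gt0 ?ltr0n.
have up_bound (k : nat) : (0 < k)%N -> 2 * (k%:R ^+ 2 * fine N) <=
    (2 + (k%:R + m%:R) * P + (k%:R + m%:R) ^+ 2 * T) * r.
  move=> k0; have km0 : (0 < k + m)%N by rewrite addn_gt0 k0.
  have [s [us sK hs]] := count (k + m)%N km0.
  have := upper k m w s k0 m0 hm us sK;
    rewrite -(fineK Kf) lee_fin -natrD -hs mulrA ler_pdivlMr.
    by rewrite -[2 * _ * r]mulrA ler_pM2l// [_ * fine N]mulrC.
  by rewrite exprn_gt0 ?ltr0n.
(* Both bounds hold for all k > 0; comparing the coefficients of k^2 gives one inequality each, and
   the given constants collect the lower-order terms. *)
apply/le_anti/andP; split; rewrite -subr_le0.
  apply: (@quadratic_bound _ (r * (P / 2 + m%:R * T)) (r * (1 + m%:R * P / 2 + m%:R ^+ 2 * T / 2))).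
  by move=> k /up_bound; rewrite -/T; move: (k%:R) (m%:R) (fine N) => k' m' M; nra.
apply: (@quadratic_bound _ (2 * m%:R * fine N - r * P / 2) (m%:R ^+ 2 * fine N - r)).
by move=> k /low_bound; rewrite -/T; move: (k%:R) (m%:R) (fine N) => k' m' M; nra.
Qed.

End Tiles.

End AreaCount.

(** * Polytopes of V in the coordinates of a basis *)

Section Polygons.
Context {R : realType} {V : vectType R}.
Implicit Types (f g v : V) (n z : R * R) (u w p q : int * int) (E F : seq (int * int)).
Implicit Types (L P Q S X Y : set V).
Local Notation polygon := (@polygon R).

Lemma area_nu (e : 2.-tuple V) f g x y (S : set (R * R)) : frame f g ->
  e`_0 = pt f g x -> e`_1 = pt f g y -> area e (pt f g @` S) = nu x y S.
Proof.
move=> fg e0 e1; rewrite /area /nu; congr (_ _).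
have E c : c.1 *: e`_0 + c.2 *: e`_1 = pt f g (ell x y c).
  by rewrite e0 e1 /pt /ell /= !scalerDr !scalerA addrACA -!scalerDl.
apply/seteqP; split=> c; rewrite /= E.
  by move=> [z Sz /(frame_inj fg) <-].
by move=> Sc; exists (ell x y c).
Qed.

Lemma frame_cross f g x y : frame (pt f g x) (pt f g y) -> cross x y != 0.
Proof.
move=> fr; apply/eqP => xy.
have dep a b : a * x.1 + b * y.1 = 0 -> a * x.2 + b * y.2 = 0 -> a = 0 /\ b = 0.
  move=> h1 h2; have : pt (pt f g x) (pt f g y) (a, b) = pt (pt f g x) (pt f g y) 0.
    by rewrite pt0 /pt /= !scalerDr !scalerA addrACA -!scalerDl h1 h2 !scale0r addr0.
  by move/(frame_inj fr) => [-> ->].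
rewrite /cross in xy.
have [y2 x2] : y.2 = 0 /\ - x.2 = 0 by apply: dep; rewrite ?mulNr;
  [rewrite mulrC xy| rewrite mulrC subrr].
have [y1 x1] : y.1 = 0 /\ - x.1 = 0 by apply: dep; rewrite ?mulNr;
  [rewrite mulrC subrr|rewrite y2 (_ : x.2 = 0) ?mulr0 ?subrr//; apply/eqP; rewrite -oppr_eq0; apply/eqP].
have [/eqP] : (1 : R) = 0 /\ (0 : R) = 0.
  apply: dep; rewrite mul1r mul0r addr0; apply/eqP; rewrite -oppr_eq0; exact/eqP.
by rewrite oner_eq0.
Qed.

Lemma area_polygon (e : 2.-tuple V) f g : basis_of {:V} e -> frame f g ->
  exists2 c : R, 0 < c & forall p E F, valid E F -> pairwise slope E ->
    pairwise slope F ->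
    thick (R := R) p E F -> area e (pt f g @` polygon p E F) = (c * (twarea E F)%:~R)%:E.
Proof.
move=> he fg.
have [x e0] := frame_coord fg e`_0; have [y e1] := frame_coord fg e`_1.
have fe : frame (pt f g x) (pt f g y).
  by rewrite /frame -e0 -e1; case: e he {e0 e1} => -[|a [|b [|]]].
have xy := frame_cross fe.
exists (fine (nu x y box) / 2).
  by rewrite divr_gt0// fine_gt0//; apply/andP; split;
    [exact: nu_box_gt0|exact: nu_box_fin].
by move=> p E F v sE sF th; rewrite (area_nu _ fg e0 e1) nu_polygon.
Qed.

(** If all realizing points were collinear, the two normals of their line would confine the polygon
    to it, and its affine hull would have dimension at most 1. *)
Lemma polygon_thick f g p E F (hV : \dim {:V} = 2%N) : frame f g -> valid E F ->
  has_affine_dim (pt f g @` polygon p E F) 2 -> thick (R := R) p E F.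
Proof.
move=> fg v [x0 [U [hU dU]]].
have [A hA] := @edges_realize R p _ _ v.
have KA a : a \in A -> polygon p E F (emb a) by exact: edges_in.
have [th|nth] := pselect (exists a0 a1 a2, [/\ a0 \in A, a1 \in A, a2 \in A &
    det (a1 - a0) (a2 - a0) != 0]).
  have [a0 [a1 [a2 [h0 h1 h2 d]]]] := th.
  exact: (thick_noncollinear (KA _ h0) (KA _ h1) (KA _ h2) d).
exfalso.
have [_ [a0 a0A _]] := hA.2 0.
have [u hu] : exists u, forall z, polygon p E F z -> exists t : R,
  z = emb a0 + (t * (emb u).1, t * (emb u).2).
  have [alla|[a1 a1A a10]] : (forall a, a \in A -> a = a0) \/ exists2 a,
    a \in A & a != a0.
    have [/hasP[a aA aa]|/hasPn h] := boolP (has (fun a => a != a0) A);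
      first by right; exists a.
    by left=> a /h; rewrite negbK => /eqP.
    exists 0 => z /(polygon_edges _ hA) hz; exists 0; rewrite !mul0r.
    have h n : dot n z <= dot n (emb a0) by have [a /alla ->] := hz n.
    rewrite addr0; have := h (1,0); have := h (-1, 0); have := h (0, 1); have :=
      h (0, -1).
    rewrite /dot /= !mul0r !addr0 !add0r !mulN1r !mul1r => h1 h2 h3 h4.
    by rewrite [LHS]surjective_pairing; congr pair; lra.
  exists (a1 - a0) => z /(polygon_edges _ hA) hz; set u := a1 - a0.
  have du a : a \in A -> det u (a - a0) = 0.
    move=> aA; apply/eqP/negPn/negP => d; apply: nth; by exists a0, a1, a.
  have dz n : n = (- (emb u).2, (emb u).1) \/ n = ((emb u).2, - (emb u).1) ->
    dot n z <= dot n (emb a0).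
    move=> hn; have [a aA ha] := hz n; apply: le_trans ha _.
    have := du a aA => /(congr1 (fun i => i%:~R : R)); rewrite det_emb embB.
    by case: hn => ->; rewrite /dot /=; lra.
  have := dz _ (or_introl erefl); have := dz _ (or_intror erefl); rewrite /dot /= =>
    h1 h2.
  have u0 : u != 0 by rewrite subr_eq0.
  have hc : (emb u).1 * (z.2 - (emb a0).2) = (emb u).2 * (z.1 - (emb a0).1) by rewrite /=; lra.
  have [u1|u1] := eqVneq (emb u : R * R).1 0.
    have u2 : (emb u : R * R).2 != 0.
      apply: contra_neq u0 => u2; apply: (@emb_inj R).
      by rewrite emb0 [LHS]surjective_pairing u1 u2.
    exists ((z.2 - (emb a0).2) / (emb u).2); rewrite [LHS]surjective_pairing; congr pair.
      move: hc; rewrite u1 mul0r => /esym/eqP;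
        rewrite mulf_eq0 (negPf u2) /= subr_eq0 => /eqP ->.
      by rewrite -[RHS]/((emb a0).1 + _ * (emb u).1) u1 mulr0 addr0.
    by rewrite -[RHS]/((emb a0).2 + _ * (emb u).2) divfK// addrC subrK.
  exists ((z.1 - (emb a0).1) / (emb u).1); rewrite [LHS]surjective_pairing; congr pair.
    by rewrite -[RHS]/((emb a0).1 + _ * (emb u).1) divfK// addrC subrK.
  rewrite -[RHS]/((emb a0).2 + _ / _ * (emb u).2) mulrAC [_ * (emb u).2]mulrC -hc.
  by rewrite mulrAC mulfV// mul1r addrC subrK.
have sub : affine_hull (pt f g @` polygon p E F) `<=` flat (pt f g (emb a0)) <[pt f g (emb u)]>%VS.
  apply: smallest_sub; first by exists (pt f g (emb a0)), <[pt f g (emb u)]>%VS.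
  move=> _ [z Kz <-]; have [t ->] := hu z Kz.
  exists (t *: pt f g (emb u)); first by rewrite /= memvZ// memv_line.
  by rewrite ptD; congr (_ + _); rewrite /pt /= scalerDr !scalerA.
have Uf : U = fullv by apply/eqP; rewrite eqEdim subvf dU hV.
have : (fullv <= <[pt f g (emb u)]>)%VS.
  apply/subvP => v' _.
  have : affine_hull (pt f g @` polygon p E F) (pt f g (emb a0) + v').
    by rewrite hU Uf; exists (pt f g (emb a0) + v' - x0); rewrite /= ?memvf// addrC subrK.
  by move/sub => [w hw /addrI <-].
by move/dimvS; rewrite hV dim_vline; case: (_ != 0).
Qed.

Lemma minkowski_sum_pt f g p q E F E' F' : valid E F -> valid E' F' ->
  minkowski_sum (pt f g @` polygon p E F) (pt f g @` polygon q E' F') =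
  pt f g @` polygon (p + q) (E ++ E') (F ++ F').
Proof.
move=> v v'; apply/seteqP; split=> [_ [_ [x Kx <-] [_ [y Ky <-] <-]]|_ [z Kz <-]].
  by exists (x + y); [apply/(polygon_add _ _ _ v v'); exists x, y|rewrite ptD].
have [x [y [Kx Ky ->]]] := (polygon_add _ _ _ v v').1 Kz.
exists (pt f g x); first by exists x.
by exists (pt f g y); [exists y|rewrite ptD].
Qed.

Lemma minkowski_diff_pt f g p q E F E' F' : valid E F -> valid E' F' ->
  minkowski_diff (pt f g @` polygon p E F) (pt f g @` polygon q E' F') =
  pt f g @` polygon (p + (- q - \sum_(u <- E') u)) (E ++ F') (F ++ E').
Proof.
move=> v v'; rewrite -minkowski_sum_pt//; last exact: valid_sym.
apply/seteqP; split=> [_ [_ [x Kx <-] [_ [y Ky <-] <-]]|_ [_ [x Kx <-] [_ [y Ky <-] <-]]].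
  exists (pt f g x); first by exists x.
  exists (pt f g (- y)); last by rewrite ptN.
  by exists (- y) => //; apply/polygon_opp; rewrite ?opprK.
exists (pt f g x); first by exists x.
exists (pt f g (- y)); last by rewrite ptN opprK.
by exists (- y) => //; apply/(polygon_opp _ _ v').
Qed.

Lemma translate_pt f g p w E F :
  [set s + pt f g (emb w) | s in pt f g @` polygon p E F] = pt f g @` polygon (p + w) E F.
Proof.
apply/seteqP; split=> [_ [_ [z Kz <-] <-]|_ [z Kz <-]].
  by exists (z + emb w); [exact/polygon_shift|rewrite ptD].
exists (pt f g (z - emb w)); last by rewrite -ptD subrK.
by exists (z - emb w) => //; apply/(polygon_shift _ w); rewrite subrK.
Qed.

Lemma lattice_polytope_sub L L' P : L `<=` L' -> lattice_polytope L P ->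
  lattice_polytope L' P.
Proof. by move=> LL' [A [? ? AL ?]]; exists A; split=> //; exact: subset_trans LL'. Qed.

Lemma lattice_polytope_sorted f g P : frame f g -> lattice_polytope (lat f g) P ->
  exists p E F, [/\ valid E F, pairwise slope E, pairwise slope F,
    all prim (E ++ F) & P = pt f g @` polygon p E F].
Proof.
move=> fg /(lattice_polytopeP _ fg)[p [E [F [v ->]]]].
have [pE pF _] := v; have v' := valid_refine v; have [pE' pF' _] := v'.
have [E1 hE sE] := slope_sort pE'; have [F1 hF sF] := slope_sort pF'.
exists p, E1, F1; split=> //.
- exact: valid_perm v'.
- rewrite all_cat -(perm_all _ hE) -(perm_all _ hF).
  by apply/andP; split; apply: all_refine => u uE; apply: prim_primdiv;
    [exact: (allP pE)|exact: (allP pF)].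
- by rewrite -(polygon_perm p hE hF) polygon_refine.
Qed.

End Polygons.

(** * Lattice lengths in a lattice refined in one direction *)

Definition horizontal_length (G : seq (int * int)) : int :=
  \sum_(v <- G | v.2 == 0) `|v.1|.

(* Stretching by [B + 1] in the first coordinate changes the lattice length of
   the horizontal edges only. *)
Lemma perimeter_stretch (B : nat) G :
  (forall v, v \in G -> v.2 != 0 -> (`|v.2| %| B)%N) ->
  perimeter (map (dilate B.+1 1) G) = perimeter G + B%:Z * horizontal_length G.
Proof.
move=> h; rewrite /perimeter /horizontal_length big_map [X in _ = _ + _ * X]big_mkcond mulr_sumr -big_split /=.
rewrite !big_seq; apply: eq_bigr => v vG; rewrite /lattice_length /= mul1r abszM absz_nat.
case: ifPn => v2.
  rewrite (eqP v2) !gcdn0 mulSn PoszD PoszM -abszE.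
  by [].
rewrite mulr0 addr0; congr Posz; have /dvdnP[c ->] := h v vG v2.
by rewrite mulSn addnC mulnAC gcdnC gcdnMDl gcdnC.
Qed.

Lemma horizontal_length_eq G G' : (forall k : nat, (0 < k)%N ->
    perimeter (map (dilate k 1) G) = perimeter (map (dilate k 1) G')) ->
  horizontal_length G = horizontal_length G'.
Proof.
(* B is a multiple of every nonzero height, so the factor B + 1 is 1 modulo that height and
   preserves its gcd with the width. Comparing the factors 1 and B + 1 isolates the horizontal
   edges. *)
move=> h; pose B := (\prod_(v <- G ++ G' | v.2 != 0%R) `|v.2|)%N.
have B0 : (0 < B)%N.
  by rewrite /B; elim/big_ind: _ => // [a b|v v2];
    rewrite ?muln_gt0 ?lt0n ?absz_eq0//; move=> -> ->.
have dvdB v : v \in G ++ G' -> v.2 != 0 -> (`|v.2| %| B)%N.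
  by move=> vG v2; rewrite /B (big_rem v)//= v2 dvdn_mulr.
have := h B.+1 isT; rewrite !perimeter_stretch => [|v vG|v vG]; last 2 first.
- by apply: dvdB; rewrite mem_cat vG orbT.
- by apply: dvdB; rewrite mem_cat vG.
have h1 : perimeter G = perimeter G'.
  have := h 1%N isT; have E1 H : map (dilate 1 1) H = H.
    by rewrite -[RHS]map_id; apply: eq_map => -[a b]; rewrite /dilate /= !mul1r.
  by rewrite !E1.
by rewrite h1 => /addrI/(mulfI _); apply; rewrite eqz_nat -lt0n.
Qed.

Section Comparison.
Context {R : realType} {V : vectType R}.
Implicit Types (f g v : V) (n z : R * R) (u w p q : int * int) (E F : seq (int * int)).
Implicit Types (L P Q X Y : set V).
Local Notation polygon := (@polygon R).

Lemma suppf_change f g p q E F E' F' (x y : R * R) n : valid E F -> valid E' F' ->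
  frame f g ->
  pt f g @` polygon p E F = pt (pt f g x) (pt f g y) @` polygon q E' F' ->
  suppf p E F n = suppf q E' F' (dot n x, dot n y).
Proof.
move=> v v' fg KK'.
have tr z : pt (pt f g x) (pt f g y) z = pt f g (ell x y z).
  by rewrite /pt /ell /= !scalerDr !scalerA addrACA -!scalerDl.
have dotE z : dot n (ell x y z) = dot (dot n x, dot n y) z.
  by rewrite /dot /ell /=; ring.
apply/le_anti/andP; split.
  have [a Ka <-] := @polygon_attained R p E F n v.
  have : (pt f g @` polygon p E F) (pt f g (emb a)) by exists (emb a).
  rewrite KK' => -[z Kz]; rewrite tr => /(frame_inj fg) <-.
  by rewrite dotE; exact: Kz.
have [a Ka <-] := @polygon_attained R q E' F' (dot n x, dot n y) v'.
have : (pt (pt f g x) (pt f g y) @` polygon q E' F') (pt (pt f g x) (pt f g y) (emb a)) by exists (emb a).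
rewrite -KK' tr => -[z Kz /(frame_inj fg) zE].
by rewrite -dotE -zE; exact: Kz.
Qed.

(** In the basis (u, w) the direction u is horizontal. The lists E', F' there need not be the images
    of E, F, so the two sides are matched through the widths, which both bases share. As E and F
    consist of primitive edges, each edge parallel to u equals u. *)
Lemma count_edges f g u w p q E F E' F' : frame f g -> det u w = 1 ->
  lexpos u -> prim u -> valid E F -> all prim (E ++ F) -> valid E' F' ->
  pt f g @` polygon p E F = pt (pt f g (emb u)) (pt f g (emb w)) @` polygon q E' F' ->
  (count_mem u (E ++ F))%:Z = horizontal_length (E' ++ F').
Proof.
move=> fg uw pu gu v gEF v' KK'.
pose T (n : R * R) : R * R := (dot n (emb u), dot n (emb w)).
have hT n : absum n (E ++ F) = absum (T n) (E' ++ F').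
  rewrite -(width_absum p n v) -(width_absum q (T n) v').
  have TN : - T n = T (- n) by rewrite /T !dotNl.
  by rewrite TN !(suppf_change _ v v' fg KK').
have linT n m e : T (n.1 + e * m.1, n.2 + e * m.2) =
     ((T n).1 + e * (T m).1, (T n).2 + e * (T m).2).
  by rewrite /T /dot /=; congr pair; ring.
have uwR : (emb u).1 * (emb w).2 - (emb u).2 * (emb w).1 = 1 :> R by rewrite -det_emb uw.
(* The basis dual to (u, w): n0 is orthogonal to u and m0 has product 1 with it. [T] sends them to
   (0, 1) and (1, 0), for which the orthogonal edges are the horizontal ones, weighted by their
   length. *)
pose n0 : R * R := (- (emb u).2, (emb u).1); pose m0 : R * R := ((emb w).2, - (emb w).1).
have Tn0 : T n0 = (0, 1).
  by congr pair; rewrite /dot; [rewrite /=; ring|rewrite -[RHS]uwR /=; ring].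
have Tm0 : T m0 = (1, 0).
  by congr pair; rewrite /dot; [rewrite -[RHS]uwR /=; ring|rewrite /=; ring].
have := absum_transfer linT hT n0 m0; rewrite Tn0 Tm0 => H.
have EL : \sum_(v <- E ++ F | dot n0 (emb v) == 0) `|dot m0 (emb v)| = (count_mem u (E ++ F))%:R :> R.
  rewrite -sum1_count natr_sum [LHS]big_seq_cond [RHS]big_seq_cond; apply: eq_big =>
    [a|a].
    have [aEF|//] := boolP (a \in E ++ F); rewrite /=.
    have pa : lexpos a by have [pE pF _] := v; apply: (allP _ a aEF); rewrite all_cat pE.
    have na : dot n0 (emb a) = (det u a)%:~R by rewrite det_emb /dot /=; ring.
    rewrite na intr_eq0; apply/eqP/eqP => [ua|->]; last exact: detxx.
    exact: (prim_multiple uw pu pa (allP gEF a aEF) ua).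
  rewrite /= => /andP[aEF]; have pa : lexpos a.
    by have [pE pF _] := v; apply: (allP _ a aEF); rewrite all_cat pE.
  have na : dot n0 (emb a) = (det u a)%:~R by rewrite det_emb /dot /=; ring.
  rewrite na intr_eq0 => /eqP ua; rewrite (prim_multiple uw pu pa (allP gEF a aEF) ua).
  have -> : dot m0 (emb u) = 1 by rewrite -uwR /dot /=; ring.
  by rewrite normr1.
have ER : \sum_(v <- E' ++ F' | @dot R (0, 1) (emb v) == 0) `|@dot R (1, 0) (emb v)| = (horizontal_length (E' ++ F'))%:~R :> R.
  rewrite /horizontal_length (big_morph (fun i : int => i%:~R : R) (@intrD R) (erefl _)).
  apply: eq_big => a.
    by rewrite /dot /= mul0r add0r mul1r intr_eq0.
  by move=> _; rewrite /dot /= mul0r addr0 mul1r intr_norm.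
move: H; rewrite EL ER pmulrn => /intr_inj.
by [].
Qed.

Lemma lat_change f g u w : det u w = 1 -> lat (pt f g (emb u)) (pt f g (emb w)) = lat f g.
Proof.
move=> uw; have tr a : pt (pt f g (emb u)) (pt f g (emb w)) (emb a) =
    pt f g (emb (a.1 * u.1 + a.2 * w.1, a.1 * u.2 + a.2 * w.2)).
  by rewrite /pt /emb /= !scalerDr !scalerA addrACA -!scalerDl !intrD !intrM.
apply/seteqP; split=> _ [a ->].
  by rewrite tr; exists (a.1 * u.1 + a.2 * w.1, a.1 * u.2 + a.2 * w.2).
exists (det a w, det u a); rewrite tr; congr (pt f g (emb _)).
exact: det_coords.
Qed.

Lemma frame_divide f g k1 k2 : (0 < k1)%N -> (0 < k2)%N -> frame f g ->
  frame (k1%:R^-1 *: f) (k2%:R^-1 *: g).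
Proof.
move=> k1p k2p fg; have := @frame_change _ _ f g (k1%:R^-1, 0) (0, k2%:R^-1) fg.
rewrite /cross /= mulr0 subr0 mulf_neq0 ?invr_eq0 ?pnatr_eq0 -?lt0n// => /(_ isT).
by rewrite /pt /= !scale0r addr0 add0r.
Qed.

Lemma lat_divide f g k1 k2 : (0 < k1)%N -> (0 < k2)%N ->
  lat f g `<=` lat (k1%:R^-1 *: f) (k2%:R^-1 *: g).
Proof.
move=> k1p k2p _ [a ->]; exists (dilate k1 k2 a).
have cancel (k : nat) (t : R) : (0 < k)%N -> k%:R * t / k%:R = t.
  by move=> k0; rewrite mulrAC divff ?mul1r// pnatr_eq0 -lt0n.
by rewrite /pt /emb /= !intrM -!pmulrn !scalerA !cancel.
Qed.

Lemma pt_divide f g k1 k2 p E F : (0 < k1)%N -> (0 < k2)%N ->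
  pt f g @` polygon p E F = pt (k1%:R^-1 *: f) (k2%:R^-1 *: g) @`
     polygon (dilate k1 k2 p) (map (dilate k1 k2) E) (map (dilate k1 k2) F).
Proof.
move=> k1p k2p; have k10 : k1%:R != 0 :> R by rewrite pnatr_eq0 -lt0n.
have k20 : k2%:R != 0 :> R by rewrite pnatr_eq0 -lt0n.
apply/seteqP; split=> _ [z Kz <-].
  exists (k1%:R * z.1, k2%:R * z.2); first exact/polygon_dilate.
  by rewrite /pt /= !scalerA [k1%:R * _]mulrC [k2%:R * _]mulrC !mulfK.
exists (z.1 / k1%:R, z.2 / k2%:R); last by rewrite /pt /= !scalerA.
apply/(polygon_dilate _ _ _ _ k1p k2p).
by rewrite /= ![_%:R * (_ / _)]mulrC !divfK// -surjective_pairing.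
Qed.

Lemma card_divide f g k1 k2 p E F : (0 < k1)%N -> (0 < k2)%N -> frame f g ->
  valid E F -> pairwise slope E -> pairwise slope F ->
  2 * (#|` fset_set ((pt f g @` polygon p E F) `&` lat (k1%:R^-1 *: f) (k2%:R^-1 *: g))|)%:Z
  = 2 + perimeter (map (dilate k1 k2) (E ++ F)) + (k1 * k2)%N%:Z * twarea E F.
Proof.
move=> k1p k2p fg v sE sF; rewrite (pt_divide _ _ _ _ _ k1p k2p).
rewrite card_pick ?slope_dilate//; [|exact: frame_divide|exact: valid_dilate].
by rewrite twarea_dilate map_cat perimeter_cat !addrA.
Qed.

End Comparison.

(** * The counting function and the edges *)

(** Adding the two sum conditions cancels Y and Y' and leaves twice the sums of X and X', so X and
    X' close up, and then so do Y and Y'. *)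
Lemma valid_summands X X' Y Y' : valid (X ++ Y) (X' ++ Y') -> valid (X ++ Y') (X' ++ Y) ->
  valid X X' /\ valid Y Y'.
Proof.
case; rewrite !all_cat !big_cat /= => /andP[pX pY] /andP[pX' pY'] e1 [_ _ e2].
rewrite !big_cat /= in e2.
have half (a b : int) : a + a = b + b -> a = b by lia.
have e : \sum_(u <- X) u + \sum_(u <- X) u = \sum_(u <- X') u + \sum_(u <- X') u.
  apply: (addIr (\sum_(u <- Y) u + \sum_(u <- Y') u)).
  by rewrite addrACA e1 e2 addrACA [\sum_(u <- Y') u + _]addrC.
have eX : \sum_(u <- X) u = \sum_(u <- X') u.
  rewrite [LHS]surjective_pairing [RHS]surjective_pairing.
  by congr pair; apply: half; [move: (congr1 fst e)|move: (congr1 snd e)].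
by split; split=> //; move: e1; rewrite eX => /addrI.
Qed.

Section Main.
Context {R : realType} {V : vectType R}.
Context (hV : \dim {:V} = 2%N).
Implicit Types (f g : V) (L P Q X Y : set V).
Local Notation polygon := (@polygon R).

Lemma card_sum_diff (e : 2.-tuple V) f g P Q X Y : basis_of {:V} e -> frame f g ->
  has_affine_dim P 2 -> has_affine_dim Q 2 -> area e P = area e Q ->
  lattice_polytope (lat f g) X -> lattice_polytope (lat f g) Y ->
  lattice_translate (lat f g) (minkowski_sum X Y) P ->
  lattice_translate (lat f g) (minkowski_diff X Y) Q ->
  #|` fset_set (P `&` lat f g)| = #|` fset_set (Q `&` lat f g)|.
Proof.
move=> he fg dP dQ eA /(lattice_polytopeP _ fg)[p [E [F [v ->]]]].
move=> /(lattice_polytopeP _ fg)[q [E' [F' [v' ->]]]].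
move=> [_ [a ->]]; rewrite minkowski_sum_pt// translate_pt => EP.
move=> [_ [b ->]]; rewrite minkowski_diff_pt// translate_pt => EQ.
have vs := valid_cat v v'; have vd := valid_cat v (valid_sym v').
have [[pE pF _] [pE' pF' _]] := (vs, vd).
have [E1 hE1 sE1] := slope_sort pE; have [F1 hF1 sF1] := slope_sort pF.
have [E2 hE2 sE2] := slope_sort pE'; have [F2 hF2 sF2] := slope_sort pF'.
have v1 := valid_perm hE1 hF1 vs; have v2 := valid_perm hE2 hF2 vd.
rewrite (polygon_perm _ hE1 hF1) in EP; rewrite (polygon_perm _ hE2 hF2) in EQ.
have [c c0 hc] := area_polygon he fg.
rewrite EP EQ in dP dQ eA *.
have aP := hc _ _ _ v1 sE1 sF1 (polygon_thick hV fg v1 dP).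
have aQ := hc _ _ _ v2 sE2 sF2 (polygon_thick hV fg v2 dQ).
move: eA; rewrite aP aQ => -[] /(mulfI (lt0r_neq0 c0))/intr_inj eT.
have eN : 2 * #|` fset_set ((pt f g @` polygon (p + q + a) E1 F1) `&` lat f g)|%:Z =
          2 * #|` fset_set ((pt f g @` polygon (p + (- q - \sum_(u <- E') u) + b) E2 F2) `&` lat f g)|%:Z.
  rewrite !card_pick// eT -(perimeter_perm hE1) -(perimeter_perm hF1) -(perimeter_perm hE2) -(perimeter_perm hF2).
  rewrite !perimeter_cat; congr (_ + _); rewrite -!(addrA 2); congr (2 + _).
  by rewrite addrACA [RHS]addrACA [perimeter F' + _]addrC.
have N2 : 2 != 0 :> int by [].
by move: eN => /(mulfI N2) [].
Qed.

Lemma card_divide_eq f g p q E F E' F' (k1 k2 : nat) : frame f g ->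
  universal_counting (lat f g) (pt f g @` polygon p E F)
    = universal_counting (lat f g) (pt f g @` polygon q E' F') ->
  valid E F -> pairwise slope E -> pairwise slope F ->
  valid E' F' -> pairwise slope E' -> pairwise slope F' ->
  (0 < k1)%N -> (0 < k2)%N ->
  perimeter (map (dilate k1 k2) (E ++ F)) + (k1 * k2)%N%:Z * twarea E F =
  perimeter (map (dilate k1 k2) (E' ++ F')) + (k1 * k2)%N%:Z * twarea E' F'.
Proof.
move=> fg U v sE sF v' sE' sF' k1p k2p.
have hL' : is_lattice (lat (k1%:R^-1 *: f) (k2%:R^-1 *: g)) /\
    lat f g `<=` lat (k1%:R^-1 *: f) (k2%:R^-1 *: g).
  split; last exact: lat_divide.
  apply/(is_latticeP hV); exists (k1%:R^-1 *: f), (k2%:R^-1 *: g).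
  by split=> //; exact: frame_divide.
have := congr1 (fun F => 2 * (F (exist _ _ hL'))%:Z) U.
rewrite /universal_counting /= card_divide// card_divide//.
by rewrite -!(addrA 2) => /addrI.
Qed.

Lemma twarea_eq f g p q E F E' F' : frame f g ->
  universal_counting (lat f g) (pt f g @` polygon p E F)
    = universal_counting (lat f g) (pt f g @` polygon q E' F') ->
  valid E F -> pairwise slope E -> pairwise slope F ->
  valid E' F' -> pairwise slope E' -> pairwise slope F' ->
  twarea E F = twarea E' F'.
Proof.
move=> fg U v sE sF v' sE' sF'.
have h k := @card_divide_eq _ _ _ _ _ _ _ _ k k fg U v sE sF v' sE' sF'.
(* The perimeter scales by k and the area by k^2, so the equations for k = 1 and k = 2 determine
   both. *)
have := h 1%N isT isT; have := h 2%N isT isT; rewrite !perimeter_dilate.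
move: (perimeter _) (perimeter _) (twarea _ _) (twarea _ _) => *; lia.
Qed.

(** Multiplicities are compared one primitive u at a time. Bezout completes u to a basis of the same
    lattice, in which the refinements along u are stretchings of the first coordinate; the areas
    agree and cancel, leaving the perimeters. *)
Lemma perm_edges f g p q E F E' F' : frame f g ->
  universal_counting (lat f g) (pt f g @` polygon p E F)
    = universal_counting (lat f g) (pt f g @` polygon q E' F') ->
  valid E F -> valid E' F' -> all prim (E ++ F) -> all prim (E' ++ F') ->
  perm_eq (E ++ F) (E' ++ F').
Proof.
move=> fg U v v' gEF gEF'; apply/allP => u uin; apply/eqP.
have pu : lexpos u.
  have [[pE pF _] [pE' pF' _]] := (v, v').
  by move: uin; rewrite mem_cat => /orP[]; apply: allP; rewrite all_cat ?pE ?pE'.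
have gu : prim u by move: uin; rewrite mem_cat => /orP[]; exact: allP.
have [w uw] := prim_complement gu.
pose f' := pt f g (emb u); pose g' := pt f g (emb w).
have fg' : frame f' g'.
  apply: frame_change fg _; rewrite /cross -det_emb uw; exact: oner_neq0.
have EL : lat f' g' = lat f g by exact: lat_change.
have sorted_of P : lattice_polytope (lat f g) P -> exists p E F, [/\ valid E F,
    pairwise slope E, pairwise slope F & P = pt f' g' @` polygon p E F].
  rewrite -EL => /(lattice_polytope_sorted fg')[p1 [E1 [F1 [? ? ? _ ?]]]].
  by exists p1, E1, F1.
have [|p1 [E1 [F1 [v1 sE1 sF1 h1]]]] := sorted_of (pt f g @` polygon p E F).
  by apply/(lattice_polytopeP _ fg); exists p, E, F.
have [|p2 [E2 [F2 [v2 sE2 sF2 h2]]]] := sorted_of (pt f g @` polygon q E' F').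
  by apply/(lattice_polytopeP _ fg); exists q, E', F'.
have U' := U; rewrite h1 h2 -EL in U'.
have eT := twarea_eq fg' U' v1 sE1 sF1 v2 sE2 sF2.
have hs : horizontal_length (E1 ++ F1) = horizontal_length (E2 ++ F2).
  apply: horizontal_length_eq => k k0.
  have := card_divide_eq fg' U' v1 sE1 sF1 v2 sE2 sF2 k0 (isT : (0 < 1)%N).
  by rewrite eT => /addIr.
have := count_edges fg uw pu gu v gEF v1 h1.
rewrite hs -(count_edges fg uw pu gu v' gEF' v2 h2).
by move=> [].
Qed.

End Main.

Theorem theorem3 (R : realType) (V : vectType R) (hV : \dim {:V} = 2%N)
  (L : set V) (hL : is_lattice L)
  (e : 2.-tuple V) (he : basis_of {:V} e)
  (P Q : set V) (hP : lattice_polygon L P) (hQ : lattice_polygon L Q) :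
  universal_counting L P = universal_counting L Q <->
  area e P = area e Q /\
  (exists X Y : set V,
    [/\ lattice_polytope L X, lattice_polytope L Y,
        lattice_translate L (minkowski_sum X Y) P &
        lattice_translate L (minkowski_diff X Y) Q]).
Proof.
have [pP dP] := hP; have [pQ dQ] := hQ.
split=> [U|[eA [X [Y [pX pY tP tQ]]]]]; last first.
  apply/funext => -[L' hL']; have [/(is_latticeP hV)[f [g [fg EL']]] LL'] := hL'.
  (* X, Y and the translation vectors are also data for the larger lattice, so both counts can be
     computed in a basis of it. *)
  rewrite /universal_counting /= {hL'}EL' in LL' *.
  have tr S T : lattice_translate L S T -> lattice_translate (lat f g) S T.
    by move=> [v Lv ->]; exists v => //; exact: LL'.
  apply: (card_sum_diff hV he fg dP dQ eA) (tr _ _ tP) (tr _ _ tQ).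
    exact: lattice_polytope_sub pX.
  exact: lattice_polytope_sub pY.
have [f [g [fg EL]]] := (is_latticeP hV L).1 hL; rewrite {hL hP hQ}EL in U pP pQ *.
have [p [E [F [v sE sF gEF EP]]]] := lattice_polytope_sorted fg pP.
have [q [E' [F' [v' sE' sF' gEF' EQ]]]] := lattice_polytope_sorted fg pQ.
rewrite {}EP {}EQ in U dP dQ *; split.
  have [c _ hc] := area_polygon he fg.
  have aP := hc _ _ _ v sE sF (polygon_thick hV fg v dP).
  have aQ := hc _ _ _ v' sE' sF' (polygon_thick hV fg v' dQ).
  by rewrite aP aQ (twarea_eq hV fg U v sE sF v' sE' sF').
have [X [X' [Y [Y' [hE hF hE' hF']]]]] := perm_refine (perm_edges hV fg U v v' gEF gEF').
have [vX vY] := valid_summands (valid_perm hE hF v) (valid_perm hE' hF' v').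
exists (pt f g @` polygon p X X'), (pt f g @` polygon 0 Y Y'); split.
- by apply/(lattice_polytopeP _ fg); exists p, X, X'.
- by apply/(lattice_polytopeP _ fg); exists 0, Y, Y'.
- exists (pt f g (emb 0)); first by exists 0.
  by rewrite minkowski_sum_pt// translate_pt !addr0 (polygon_perm _ hE hF).
(* The lexicographically smallest vertex of X - Y, where Y was placed at the origin; Q has its
   smallest vertex at q. *)
set s := p + (- 0 - \sum_(u <- Y) u).
exists (pt f g (emb (q - s))); first by exists (q - s).
by rewrite minkowski_diff_pt// translate_pt -/s addrC subrK (polygon_perm _ hE' hF').
Qed.
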